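(* Any tree $(T,d,F)\in\mathbb{P}\mathcal{T}_3(2)\cup\mathbb{P}\mathcal{T}_3(1)$ is uniquely determined by its code: if two elements of $\mathbb{P}\mathcal{T}_3(2)\cup\mathbb{P}\mathcal{T}_3(1)$ have the same code, then they are equal (as elements of $\mathbb{P}\mathcal{T}_3$).
   Context: Abstract trees. A simplicial tree $T$ is a nonempty, connected, locally finite, 1-dimensional simplicial complex without cycles, with vertex set $V(T)$ and set of (unoriented, closed) edges $E(T)$; $E_v(T)$ is the finite set of edges adjacent to a vertex $v$ and the valence of $v$ is $|E_v(T)|$. The space of ends $\partial T$ is the inverse limit of the sets of connected components of $T-K$ over finite subtrees $K$. A branched covering $F:T_1\to T_2$ of simplicial trees is a proper, open, continuous map which is simplicial (every edge maps linearly onto an edge). A local degree function for $F$ is a map $\deg:E(T_1)\cup V(T_1)\to\{1,2,3,\dots\}$ such that for every $v\in V(T_1)$ one has $2\deg(v)-2\ge\sum_{e\in E_v(T_1)}(\deg(e)-1)$, and for every $e\in E_v(T_1)$ one has $\deg(v)=\sum_{e'\in E_v(T_1):F(e')=F(e)}\deg(e')$. The global degree is $\deg(F)=\sum_{F(e_1)=e_2}\deg(e_1)$ (independent of $e_2$). Two points $x,y\in T$ are in the same grand orbit of $F:T\to T$ if $F^a(x)=F^b(y)$ for some $a,b>0$. A branched covering $F:T\to T$ is polynomial-like if: (I) there is a unique isolated end $\infty\in\partial T$; (II) there exists a local degree function compatible with $F$; (III) $T$ has no vertices of valence one; (IV) the grand orbit of any vertex includes a vertex of valence 3 or more. (The local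 degree function is then unique.) Its Julia set is $J(F)=\partial T-\{\infty\}$. A height metric is a path metric $d$ on $T$ ($d(x,y)+d(y,z)=d(x,z)$ whenever $y$ lies on the arc from $x$ to $z$), linear on edges, with $d(F(e))=\deg(F)\,d(e)$ for every edge $e$. A metrized polynomial-like tree is a triple $(T,d,F)$; equivalence means an isometry conjugating the dynamics. $\mathcal{T}_3$ is the set of equivalence classes with $\deg(F)=3$; $\mathbb{P}\mathcal{T}_3=\mathcal{T}_3/\mathbb{R}_+$ (rescaling $d$). Critical points. The critical multiplicity of a vertex $v$ is $m(v)=2\deg(v)-2-\sum_{e\in E_v(T)}(\deg(e)-1)$; for $p\in J(F)$ it is $m(p)=\lim\deg(w_i)-1$, where $w_i$ is a sequence of consecutive vertices converging to $p$. Critical points are points of $V(T)\cup J(F)$ of positive multiplicity; for degree 3 the total multiplicity is 2. $\mathbb{P}\mathcal{T}_3(2)$ is the set of classes of trees for which both critical points (counted with multiplicity) lie in $V(T)$ and in the same grand orbit; $\mathbb{P}\mathcal{T}_3(1)$ is the set of those for which exactly one critical point lies in $V(T)$ (the other lying in $J(F)$). Notation for $(T,d,F)\in\mathbb{P}\mathcal{T}_3(2)\cup\mathbb{P}\mathcal{T}_3(1)$. The base $v_0$ is the unique vertex of valence $\ge3$ closest to $\infty$; it is a critical point, and $c_0$ denotes the remaining critical point ($c_0=v_0$ if $v_0$ has multiplicity 2). The combinatorial height $h:V(T)\to\mathbb{Z}$ has $|h(v)|$ equal to the minimal number of edges joining $v$ to $v_0$, with $h\ge0$ on $[v_0,\infty)$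 and $h\le0$ elsewhere; here $h(F(v))=h(v)+1$. Let $v_i$ ($i\ge0$) be the vertex on $[v_0,\infty)$ with $h(v_i)=i$, so $v_i=F^i(v_0)$. The level is $\ell=\log(H(v_0)/H(c_0))/\log3\in[0,\infty]$, where $H(x)=d(x,J(F))$ (distance in the metric completion $T\cup J(F)$); $\ell$ is a finite integer on $\mathbb{P}\mathcal{T}_3(2)$ and $\ell=\infty$ on $\mathbb{P}\mathcal{T}_3(1)$. The spine is the sequence of consecutive vertices $(s_0,s_1,\dots,s_\ell)$ with $s_0=v_0$, $s_\ell=c_0$ if $\ell<\infty$; if $\ell=\infty$ it is the infinite sequence of consecutive vertices $(s_0,s_1,s_2,\dots)$ along the path from $v_0$ to $c_0\in J(F)$. Code. Let $S\subset V(T)$ be the union of the forward orbits (including the starting points) of the vertices $s_i$ in the spine. Define $g:S\to\{0,1,2,\dots\}$ by letting $g(v)$ be the least $i$ such that $v$ is in the forward orbit of $s_i$. Let $N\subset S$ be the set of vertices in $S$ at combinatorial distance $\le1$ from the unique path joining $c_0$ to $\infty$ (through the spine, $v_0$, and $v_1,v_2,\dots$). Let $F_N:N\to N$ be the first return map: $F_N(v)=F^j(v)$ for the least $j>0$ with $F^j(v)\in N$. For $1\le i\le\ell$ ($i\ge1$ if $\ell=\infty$) let the lifetime $k(i)$ be the number of vertices $v\in N$ with $g(v)=i$, and the terminus $t(i)$ be the value of $g(F_N^j(s_i))$ for the least $j>0$ such that $g(F_N^j(s_i))\ne i$. The code of $(T,d,F)$ is the (finite or infinite) sequence $(k(i),t(i))$,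 $i=1,\dots,\ell$ (empty if $\ell=0$). *)

(* Defs.v *)
From HB Require Import structures.
From mathcomp Require Import all_boot all_order all_algebra finmap.
From mathcomp Require Import all_classical all_reals all_analysis.
Import Order.TTheory GRing.Theory Num.Theory numFieldNormedType.Exports.

Set Implicit Arguments.
Unset Strict Implicit.
Unset Printing Implicit Defensive.

Local Open Scope classical_set_scope.
Local Open Scope ring_scope.

(* A 1-dimensional simplicial complex is given by its vertices and its edge
   relation.  Nonemptiness is the [pointedType] structure on the vertices, local
   finiteness is the finiteness of the set [nbr v] of neighbours of [v]; the
   edges adjacent to [v] are in bijection with [nbr v].  The chosen point is
   not part of the geometry: isomorphisms ignore it. *)
Record tree := Tree {
  vtx :> pointedType;
  nbr : vtx -> {fset vtx};
  nbr_sym : forall u v, (u \in nbr v) = (v \in nbr u);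
  nbr_irr : forall v, v \notin nbr v;
  tree_connected : forall u v : vtx,
    exists2 p, path [rel x y | y \in nbr x] u p & last u p = v;
  tree_acyclic : forall c : seq vtx,
    ucycle [rel x y | y \in nbr x] c -> (size c < 3)%N }.

Definition adj (T : tree) : rel T := [rel u v | v \in nbr u].

Definition valence (T : tree) (v : T) : nat := #|` nbr v|.

Definition joined (T : tree) (A : set T) (u v : T) : Prop :=
  exists p : seq T,
    [/\ path (@adj T) u p, last u p = v & forall x, x \in u :: p -> A x].

Record subtree (T : tree) := Subtree {
  subtree_vtx :> {fset T};
  subtree_neq0 : subtree_vtx != fset0;
  subtree_connected : forall u v, u \in subtree_vtx -> v \in subtree_vtx ->
    joined [set` subtree_vtx] u v }.

(* The vertex set of a connected component of T - K.  A component of T - K is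
   determined by its vertices: since T has no cycles, K contains every edge
   both of whose endpoints are in K. *)
Definition is_component (T : tree) (K : subtree T) (C : set T) : Prop :=
  exists2 v, v \notin (K : {fset T}) & C = joined [set x | x \notin (K : {fset T})] v.

(* A point of the inverse limit of the sets of components of T - K. *)
Record tend (T : tree) := TEnd {
  ecomp : subtree T -> set T;
  ecomp_component : forall K, is_component K (ecomp K);
  ecomp_compat : forall K K' : subtree T,
    (K `<=` K')%fset -> ecomp K' `<=` ecomp K }.

HB.instance Definition _ (T : tree) := gen_eqMixin (tend T).
HB.instance Definition _ (T : tree) := gen_choiceMixin (tend T).

(* {e} is open for the inverse limit topology; the finite subtrees being
   directed, the sets [set e' | ecomp e' K = ecomp e K] form a neighbourhood
   basis at e. *)
Definition isolated_end (T : tree) (e : tend T) : Prop :=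
  exists K : subtree T, forall e' : tend T, ecomp e' K = ecomp e K -> e' = e.

Definition consecutive (T : tree) (w : nat -> T) : Prop :=
  forall i, adj (w i) (w i.+1).

Definition cvg_end (T : tree) (w : nat -> T) (e : tend T) : Prop :=
  forall K : subtree T, \forall i \near \oo, ecomp e K (w i).

(* w lists the vertices of the half-line [u, e) starting at u. *)
Definition is_ray (T : tree) (u : T) (e : tend T) (w : nat -> T) : Prop :=
  [/\ w 0%N = u, consecutive w, injective w & cvg_end w e].

Definition ray (T : tree) (u : T) (e : tend T) : nat -> T :=
  xget (fun=> u) [set w : nat -> T | is_ray u e w].

(* The geometric realization of T, in barycentric coordinates: nonnegative
   functions of total mass 1 supported on a simplex.  As T is locally finite,
   the topology of pointwise convergence is the usual one. *)
Definition realization (R : realType) (T : tree) : set {ptws T -> R} :=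
  [set x : T -> R |
    [/\ forall v, 0 <= x v,
        forall u v, x u != 0 -> x v != 0 -> u = v \/ adj u v &
        \sum_(v \in [set: T]) x v = 1]].
Arguments realization : clear implicits.

(* The affine extension to the realizations of a map on vertices. *)
Definition realize (R : realType) (T1 T2 : tree) (F : T1 -> T2)
    (x : {ptws T1 -> R}) : {ptws T2 -> R} :=
  fun w => \sum_(v \in F @^-1` [set w]) x v.
Arguments realize : clear implicits.

(* A simplicial map is given by its values on the vertices; edges are mapped
   onto edges, so no edge is collapsed. *)
Record branched_covering (R : realType) (T1 T2 : tree) (F : T1 -> T2) : Prop := {
  bc_simplicial : forall u v, adj u v -> adj (F u) (F v);
  bc_continuous : {within realization R T1, continuous (realize R T1 T2 F)};
  bc_open : forall U : set {ptws T1 -> R}, open U ->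
    exists2 W : set {ptws T2 -> R}, open W &
      realize R T1 T2 F @` (realization R T1 `&` U) = realization R T2 `&` W;
  bc_proper : forall K : set {ptws T2 -> R},
    K `<=` realization R T2 -> compact K ->
    compact (realization R T1 `&` realize R T1 T2 F @^-1` K) }.
Arguments branched_covering : clear implicits.

(* The degree of a vertex v is dv v, that of the edge {v, w} is
   de v w = de w v; the values of de off the edges are irrelevant.  The
   truncated subtractions below are exact since all degrees are positive. *)
Record local_degree (T1 T2 : tree) (F : T1 -> T2)
    (dv : T1 -> nat) (de : T1 -> T1 -> nat) : Prop := {
  dv_gt0 : forall v, (0 < dv v)%N;
  de_gt0 : forall v w, adj v w -> (0 < de v w)%N;
  de_sym : forall v w, adj v w -> de v w = de w v;
  dv_ge : forall v, (\sum_(w <- nbr v) (de v w - 1) <= 2 * dv v - 2)%N;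
  dv_sum : forall v w, adj v w ->
    dv v = (\sum_(w' <- nbr v | F w' == F w) de v w')%N }.

(* The sum of de over the edges mapped onto the edge {a, b}; each of them has
   exactly one orientation mapped to (a, b). *)
Definition edge_degree (T1 T2 : tree) (F : T1 -> T2) (de : T1 -> T1 -> nat)
    (a b : T2) : nat :=
  \sum_(e \in [set e : T1 * T1 | [/\ adj e.1 e.2, F e.1 = a & F e.2 = b]])
     de e.1 e.2.

Definition same_grand_orbit (T : Type) (F : T -> T) (x y : T) : Prop :=
  exists a b, [/\ (0 < a)%N, (0 < b)%N & iter a F x = iter b F y].

(* The isolated end and the local degree function are unique, so keeping them
   as fields is the same as asserting their existence. *)
Record poly_tree (R : realType) := PolyTree {
  ptree :> tree;
  dyn : ptree -> ptree;
  dyn_bc : branched_covering R ptree ptree dyn;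
  inf_end : tend ptree;
  inf_endP : forall e : tend ptree, isolated_end e <-> e = inf_end;
  vdeg : ptree -> nat;
  edeg : ptree -> ptree -> nat;
  degP : local_degree dyn vdeg edeg;
  valence_neq1 : forall v : ptree, valence v <> 1%N;
  grand_orbitP : forall v : ptree,
    exists2 w : ptree, same_grand_orbit dyn v w & (3 <= valence w)%N }.

Arguments dyn {R p}.
Arguments vdeg {R p}.
Arguments edeg {R p}.
Arguments inf_end {R} p.

(* The common value of [edge_degree] over all edges. *)
Definition global_degree (R : realType) (T : poly_tree R) : nat :=
  xget 0%N [set n | forall a b : T, adj a b ->
                      edge_degree (@dyn R T) edeg a b = n].

(* A metric linear on edges is determined by the distances between vertices;
   the arc between two vertices is the unique simple path joining them. *)
Record height_metric (R : realType) (T : poly_tree R) (d : T -> T -> R) : Prop := {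
  dist_eq0 : forall x y, d x y = 0 <-> x = y;
  dist_sym : forall x y, d x y = d y x;
  dist_triangle : forall x y z, d x z <= d x y + d y z;
  dist_path : forall (x y : T) (p : seq T),
    path (@adj T) x p -> uniq (x :: p) -> y \in x :: p ->
    d x y + d y (last x p) = d x (last x p);
  dist_dyn : forall x y, adj x y ->
    d (dyn x) (dyn y) = (global_degree T)%:R * d x y }.

Record metrized_tree (R : realType) := MetrizedTree {
  mtree :> poly_tree R;
  dist : mtree -> mtree -> R;
  distP : height_metric dist }.

(* Equality of classes modulo isometries conjugating the dynamics and positive
   rescalings of the metric.  The vertices are the points whose grand orbit
   contains a branch point, so such isometries preserve vertices, and they are
   determined by their values there; conversely a bijection between vertices
   preserving the distances preserves the edges. *)
Definition proj_equiv (R : realType) (T1 T2 : metrized_tree R) : Prop :=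
  exists c : R, 0 < c /\
  exists phi : T1 -> T2,
    [/\ bijective phi,
        forall x y, dist (phi x) (phi y) = c * dist x y &
        forall x, phi (dyn x) = dyn (phi x)].

Section Critical.
Context {R : realType}.
Variable T : metrized_tree R.

Definition julia := {p : tend T | p != inf_end T}.

Definition vpoint := (T + julia)%type.

Definition vmult (v : T) : nat :=
  (2 * vdeg v - 2 - \sum_(w <- nbr v) (edeg v w - 1))%N.

Definition jmult (p : julia) : nat :=
  xget 0%N [set m | exists w : nat -> T,
    [/\ consecutive w, cvg_end w (val p) &
        (fun i => (vdeg (w i) - 1)%N) @ \oo --> m]].

Definition mult (x : vpoint) : nat :=
  match x with inl v => vmult v | inr p => jmult p end.

Definition in_PT3_2 : Prop :=
  [/\ global_degree T = 3%N,
      forall x, (0 < mult x)%N -> exists v, x = inl v &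
      forall u v : T, (0 < vmult u)%N -> (0 < vmult v)%N ->
        same_grand_orbit dyn u v].

(* The total multiplicity being 2, both critical points are simple. *)
Definition in_PT3_1 : Prop :=
  global_degree T = 3%N /\
  exists (v : T) (p : julia),
    [/\ vmult v = 1%N, jmult p = 1%N &
        forall x, (0 < mult x)%N -> x = inl v \/ x = inr p].

(* The vertex of valence at least 3 closest to infinity: the half-line to
   infinity from any vertex of valence at least 3 passes through it. *)
Definition is_base (v : T) : Prop :=
  (3 <= valence v)%N /\
  forall u : T, (3 <= valence u)%N -> exists i, ray u (inf_end T) i = v.

Definition base : T := xget point [set v | is_base v].

Definition other_crit : vpoint :=
  xget (inl base) [set x : vpoint |
    if vmult base == 2%N then x = inl base
    else x <> inl base /\ (0 < mult x)%N].

(* A sequence of vertices converging to x in the metric completion. *)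
Definition approach (x : vpoint) : nat -> T :=
  match x with inl v => fun=> v | inr p => ray base (val p) end.

(* The distance of the metric completion of T. *)
Definition cdist (x y : vpoint) : R :=
  lim ((fun i => dist (approach x i) (approach y i)) @ \oo).

Definition height (x : vpoint) : R :=
  inf [set cdist x (inr p) | p in [set: julia]].

Definition level : \bar R :=
  if height other_crit == 0 then +oo%E
  else (ln (height (inl base) / height other_crit) / ln 3)%:E.

(* Only the terms s i with i <= level are meaningful. *)
Definition is_spine (s : nat -> T) : Prop :=
  [/\ s 0%N = base,
      forall i, (i.+1%:R%:E <= level)%E -> adj (s i) (s i.+1),
      {in [set i | (i%:R%:E <= level)%E] &, injective s},
      forall l : nat, level = (l%:R)%:E -> other_crit = inl (s l) &
      level = +oo%E ->
        exists2 p : julia, other_crit = inr p & cvg_end s (val p)].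

Definition spine : nat -> T := xget (fun=> base) [set s | is_spine s].

(* The least element of A (0 if A is empty). *)
Definition least (A : set nat) : nat :=
  xget 0%N [set n | A n /\ forall m, A m -> (n <= m)%N].

Definition in_orbit_of_spine (i : nat) (v : T) : Prop :=
  (i%:R%:E <= level)%E /\
  exists j, v = iter j dyn (spine i).

Definition S_set : set T := [set v | exists i, in_orbit_of_spine i v].

Definition g (v : T) : nat := least [set i | in_orbit_of_spine i v].

(* The vertices of the path joining c_0 to infinity: the spine and the
   v_i, i >= 0. *)
Definition axis : set T :=
  [set v | (exists2 i : nat, (i%:R%:E <= level)%E & v = spine i) \/
           (exists i, v = ray base (inf_end T) i)].

Definition N_set : set T :=
  S_set `&` [set v | exists2 u, axis u & u = v \/ adj u v].

Definition first_return (v : T) : T :=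
  iter (least [set j | (0 < j)%N /\ N_set (iter j dyn v)])
    dyn v.

Definition lifetime (i : nat) : nat :=
  #|` fset_set [set v | N_set v /\ g v = i]|.

Definition terminus (i : nat) : nat :=
  g (iter (least [set j | (0 < j)%N /\ g (iter j first_return (spine i)) <> i])
       first_return (spine i)).

(* The i-th term of the code, None when i is not in [1, level]; hence equality
   of codes includes equality of their lengths. *)
Definition tree_code (i : nat) : option (nat * nat) :=
  if (0 < i)%N && (i%:R%:E <= level)%E then Some (lifetime i, terminus i)
  else None.

End Critical.

(* Main.v *)
Require Import Defs.
From HB Require Import structures.
From mathcomp Require Import all_boot all_order all_algebra finmap.
From mathcomp Require Import all_classical all_reals all_analysis.
From mathcomp Require Import zify ring lra.
Import Order.TTheory GRing.Theory Num.Theory numFieldNormedType.Exports.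

Set Implicit Arguments.
Unset Strict Implicit.
Unset Printing Implicit Defensive.

Local Open Scope classical_set_scope.

(** Seen from its isolated end, a tree T with dynamics F is a rooted object:
    every vertex x has one neighbour up x towards infinity, the others are its
    children, and F commutes with up. Above the base v0 there is only the ray
    v0, v1, v2, ..., on which F is the shift. Below v0 a vertex of depth n is
    mapped to a vertex of depth n - 1, and F maps the children of x onto those
    of F x; the degree of x is the number of children of x, counted with their
    degrees, over each child of F x. Since v0 has degree 3 and at least two
    children, and the degrees minus 1 of the children of x add up to at most
    the degree minus 1 of x, the vertices of degree at least 2 below v0 form a
    single descending path, the spine, and their degree is 2. So T is built
    level by level, and the only freedom is to decide, for each n, over which
    child of F s_n the vertex s_(n+1) lies.

    The proof has two halves. The first one shows that the code determines all
    coincidences F^j s_i = F^j' s_i' between points of the orbits of the spine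
    ([code_orbits_agree]). Assume this up to the index n and follow the orbit
    of s_(n+1), whose parents form the orbit of s_n. When the parent of F^k
    s_(n+1) lies on the spine, F^k s_(n+1) belongs to the neighbourhood N of
    the axis, so these moments are known from the orbit of s_n; the orbit of
    s_(n+1) has joined an earlier orbit at such a moment exactly when the
    number of earlier moments of this kind is at least k(n+1), and it has then
    joined the orbit of s_(t(n+1)) ([code_step]), whose coincidences with the
    others are known. At the other moments the parent of F^k s_(n+1) has
    degree 1, so that F is injective on its children: whether F^k s_(n+1)
    equals F^j s_i can be read off from the parents and from the images of
    both.

    The second half is an extension argument. The bijection F^j s_i |-> F^j
    s_i between the orbits of the two spines commutes with F and with up. The
    set of children of p over a given child of F p is finite, and its size
    only depends on the position of p and of this child relatively to the
    spine ([card_fibre]); so a partial bijection between two corresponding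
    sets extends to a bijection. This produces, one depth after the other, a
    bijection of the trees that commutes with F and with up ([coherentP],
    [tree_iso_bij]). Since the length of an edge is multiplied by 3 by F, all
    lengths are fixed by the length of the edge [v0, v1], and this bijection
    is a similarity ([dist_ratio]).

    Before this, the description above must be extracted from the axioms. The
    main point is that F commutes with up ([dyn_up]). A lift of the ray v0,
    v1, ... that goes away from infinity would converge to an end different
    from infinity, hence not isolated, and would thus have infinitely many
    side branches; each of them contains an edge over [v0, v1], or one over
    every edge of the ray that is high enough, whereas no edge has more than
    three preimages ([no_descending_lift]). Hence F v0 = v_k for some k; k = 0
    is excluded by the metric, and for k > 1 there would be a critical vertex
    whose grand orbit does not contain v0 ([dyn_base]). Finally the distance
    of a vertex of depth n to the Julia set is that of v0 divided by 3^n
    ([height_depth]), which identifies the level with the length of the spine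
    ([levelP], [spineE]). *)

(** * Walks in trees *)

Section Joined.
Variable T : tree.
Implicit Types (u v x y : T) (A B : set T).

Lemma adj_sym u v : adj u v = adj v u.
Proof. by rewrite /adj /= nbr_sym. Qed.

Lemma adj_irr u : ~~ adj u u.
Proof. exact: nbr_irr. Qed.

Lemma adj_neq u v : adj u v -> u != v.
Proof. by apply: contraTneq => ->; exact: adj_irr. Qed.

Lemma joined_refl A u : A u -> joined A u u.
Proof. by move=> Au; exists [::]; split=> // x; rewrite inE => /eqP ->. Qed.

Lemma joined_trans A v u w : joined A u v -> joined A v w -> joined A u w.
Proof.
move=> [p [pp <- pA]] [q [qp <- qA]]; exists (p ++ q); split.
- by rewrite cat_path pp.
- by rewrite last_cat.
- move=> x; rewrite -cat_cons mem_cat => /orP[/pA //|xq].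
  by apply: qA; rewrite inE xq orbT.
Qed.

Lemma joined_sym A u v : joined A u v -> joined A v u.
Proof.
move=> [p [pp <- pA]]; exists (rev (belast u p)); split.
- by rewrite rev_path; apply: sub_path pp => x y; rewrite adj_sym.
- by case: p {pp pA} => //= a p; rewrite rev_cons last_rcons.
- move=> x xp; apply: pA; rewrite lastI mem_rcons; move: xp.
  by rewrite !inE mem_rev.
Qed.

Lemma joined_adj A u v : A u -> A v -> adj u v -> joined A u v.
Proof.
move=> Au Av uv; exists [:: v]; split; rewrite //= ?andbT //.
by move=> x; rewrite !inE => /orP[] /eqP ->.
Qed.

Lemma joined_endl A u v : joined A u v -> A u.
Proof. by move=> [p [_ _]]; apply; rewrite inE eqxx. Qed.

Lemma joined_endr A u v : joined A u v -> A v.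
Proof. by move/joined_sym/joined_endl. Qed.

Lemma joined_sub A B u v : A `<=` B -> joined A u v -> joined B u v.
Proof. by move=> AB [p [pp pl pA]]; exists p; split=> // x /pA /AB. Qed.

Lemma joined_ind (P : T -> Prop) A u v :
  P u -> (forall x y, A x -> A y -> adj x y -> P x -> P y) ->
  joined A u v -> P v.
Proof.
move=> Pu PS [p]; elim: p u Pu => [|a p IH] u Pu [] /=; first by move=> _ <-.
move=> /andP[ua pp] pl pA; apply: (IH a).
  by apply: (PS u) => //; apply: pA; rewrite !inE eqxx ?orbT.
by split=> // x xp; apply: pA; rewrite inE xp orbT.
Qed.

Lemma joinedT u v : joined setT u v.
Proof. by have [p pp pl] := tree_connected u v; exists p; split. Qed.

(** The first vertex of the walk outside of B is preceded by a vertex that was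
    reached inside B. *)
Lemma joined_exit A B u v : B u -> ~ B v -> joined A u v ->
  exists x y, [/\ A x, A y, adj x y, ~ B y & joined (A `&` B) u x].
Proof.
move=> Bu nBv uv; apply: contrapT => H; apply: nBv.
suff: joined (A `&` B) u v by move/joined_endr=> -[].
apply: (@joined_ind (joined (A `&` B) u) A u v) => //.
  by apply: joined_refl; split=> //; exact: joined_endl uv.
move=> x y Ax Ay xy ux; have [By|nBy] := pselect (B y).
  by apply: (joined_trans ux); apply: joined_adj => //; exact: joined_endr ux.
by case: H; exists x, y.
Qed.

(** Two different neighbours of u joined in the complement of u would give a
    cycle through u. *)
Lemma adj_joined_eq u a b : adj u a -> adj u b ->
  joined [set x | x != u] a b -> a = b.
Proof.
move=> ua ub [p [pp pl pA]]; apply/eqP/negP => /negP ab.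
move: pl pA; case/shortenP: pp => p' pp' up' sp' pl pA.
have p'A x : x \in a :: p' -> x != u.
  rewrite inE => /orP[/eqP ->|/sp' xp]; first by apply: pA; rewrite inE eqxx.
  by apply: pA; rewrite inE xp orbT.
have p0 : p' != [::] by apply: contraNneq ab => p0; rewrite -pl p0.
have := @tree_acyclic T (u :: a :: p'); rewrite /ucycle.
have -> /= : size (u :: a :: p') < 3 = false by case: (p') p0.
move=> H; suff: false by []; apply: H; apply/andP; split; last first.
  by rewrite -/(uniq (a :: p')) up' andbT; apply/negP => /p'A; rewrite eqxx.
apply/andP; split=> //; rewrite rcons_path pl -/(adj _) //.
by apply/andP; split=> //; rewrite -/(@adj T b u) adj_sym.
Qed.

End Joined.

(** * Components of the complement of a finite subtree *)

Section SmallSubtrees.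
Variable T : tree.

Fact single_subtree_neq0 (u : T) : [fset u]%fset != fset0.
Proof. by apply/fset0Pn; exists u; rewrite inE. Qed.

Fact single_subtree_connected (u x y : T) : x \in [fset u]%fset ->
  y \in [fset u]%fset ->
  joined [set` [fset u]%fset] x y.
Proof.
by rewrite !inE => /eqP -> /eqP ->; apply: joined_refl; rewrite /= inE.
Qed.

Definition single_subtree (u : T) : subtree T :=
  Subtree (single_subtree_neq0 u) (@single_subtree_connected u).

Fact edge_subtree_neq0 (u v : T) : [fset u; v]%fset != fset0.
Proof. by apply/fset0Pn; exists u; rewrite !inE eqxx. Qed.

Fact edge_subtree_connected (u v : T) (uv : adj u v) x y :
  x \in [fset u; v]%fset ->
  y \in [fset u; v]%fset -> joined [set` [fset u; v]%fset] x y.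
Proof.
rewrite !inE => /orP[] /eqP -> /orP[] /eqP ->.
- by apply: joined_refl; rewrite /= !inE eqxx.
- by apply: joined_adj; rewrite //= !inE eqxx ?orbT.
- by apply: joined_adj; rewrite //= ?(adj_sym v) // !inE eqxx ?orbT.
- by apply: joined_refl; rewrite /= !inE eqxx orbT.
Qed.

Definition edge_subtree (u v : T) (uv : adj u v) : subtree T :=
  Subtree (edge_subtree_neq0 u v) (edge_subtree_connected uv).

Lemma componentP (K : subtree T) (C : set T) (x y : T) :
  is_component K C -> C x ->
  C y <-> joined [set x | x \notin (K : {fset T})] x y.
Proof.
move=> [v vK ->] vx; split=> [|xy]; last exact: joined_trans vx xy.
exact: joined_trans (joined_sym vx).
Qed.

Lemma componentN (K : subtree T) (C : set T) (x : T) :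
  is_component K C -> C x -> x \notin (K : {fset T}).
Proof. by move=> [v vK ->] /joined_endr. Qed.

Lemma component_neq0 (K : subtree T) (C : set T) :
  is_component K C -> exists x, C x.
Proof. by move=> [v vK ->]; exists v; apply: joined_refl. Qed.

Lemma component_adj (K : subtree T) (C : set T) (x y : T) :
  is_component K C -> C x -> adj x y -> y \notin (K : {fset T}) -> C y.
Proof.
move=> KC Cx xy yK; apply/(componentP y KC Cx); apply: joined_adj => //.
exact: componentN Cx.
Qed.

(** A walk from the component to a vertex of K leaves the component through an
    edge whose other endpoint is in K, by maximality. *)
Lemma component_touch (K : subtree T) (C : set T) : is_component K C ->
  exists x k, [/\ C x, k \in (K : {fset T}) & adj x k].
Proof.
move=> KC; have [x Cx] := component_neq0 KC.
have /fset0Pn[k kK] := subtree_neq0 K.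
have [] := @joined_exit T setT C x k Cx _ (joinedT x k).
  by move/(componentN KC); rewrite kK.
move=> a [b [_ _ ab nCb /joined_endr[_ Ca]]]; exists a, b; split=> //.
by apply: contra_notT nCb; exact: component_adj ab.
Qed.

End SmallSubtrees.

(** * The direction of an end *)

Section Ends.
Variables (T : tree).
Implicit Types (e : tend T) (u v x y : T) (K : subtree T) (w : nat -> T).

(** The neighbour of u in the direction of the end e: the component of e in
    the complement of u contains exactly one neighbour of u. *)
Definition parent e u : T :=
  xget u [set a | adj u a /\ ecomp e (single_subtree u) a].

Fact parentP e u : adj u (parent e u) /\
  ecomp e (single_subtree u) (parent e u).
Proof.
apply: (@xgetPex _ _ [set a | adj u a /\ ecomp e (single_subtree u) a]).
have [a [k [Ca]]] := component_touch (ecomp_component e (single_subtree u)).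
by rewrite inE => /eqP -> ak; exists a; split=> //; rewrite adj_sym.
Qed.

Lemma parent_adj e u : adj u (parent e u).
Proof. by have [] := parentP e u. Qed.

Lemma ecomp_parent e u : ecomp e (single_subtree u) (parent e u).
Proof. by have [] := parentP e u. Qed.

(** Two neighbours of u in the same component are equal, as the tree has no
    cycle. *)
Lemma parent_eq e u a : adj u a -> ecomp e (single_subtree u) a ->
  parent e u = a.
Proof.
move=> ua Ca; apply: (adj_joined_eq (parent_adj e u) ua).
have := proj1 (componentP a (ecomp_component e (single_subtree u))
  (ecomp_parent e u)) Ca.
by apply: joined_sub => x /=; rewrite inE.
Qed.

Lemma single_subtree_sub K u : u \in (K : {fset T}) ->
  (single_subtree u `<=` K)%fset.
Proof. by move=> uK; apply/fsubsetP => x; rewrite inE => /eqP ->. Qed.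

(** The component of e touches K at some k, and the neighbour of k in this
    component can only be its parent. *)
Lemma ecomp_touch e K : exists2 k, k \in (K : {fset T}) &
  ecomp e K (parent e k).
Proof.
have [a [k [Ca kK ak]]] := component_touch (ecomp_component e K).
exists k => //; rewrite (@parent_eq e k a) ?(adj_sym k) //.
exact: (ecomp_compat (single_subtree_sub kK)) Ca.
Qed.

(** Remove both endpoints of the edge: the component of e touches one of them,
    from which e is reached without using the edge, while from the other
    endpoint one has to cross it. *)
Lemma parent_adjP e u v : adj u v ->
  (v = parent e u /\ parent e v <> u) \/ (u = parent e v /\ parent e u <> v).
Proof.
move=> uv; have [k kK Ck] := ecomp_touch e (edge_subtree uv).
have nK := componentN (ecomp_component e _) Ck.
have pnu : parent e k != u by apply: contraNneq nK => ->; rewrite !inE eqxx.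
have pnv : parent e k != v by apply: contraNneq nK => ->;
  rewrite !inE eqxx orbT.
move: kK; rewrite !inE => /orP[] /eqP kE; subst k.
  right; split; last exact/eqP.
  apply/esym/parent_eq; rewrite ?(adj_sym v) //.
  apply: (component_adj (ecomp_component e (single_subtree v)) (x :=
    parent e u)).
  - by apply: ecomp_compat Ck; apply: single_subtree_sub;
      rewrite !inE eqxx orbT.
  - by rewrite adj_sym parent_adj.
  - by rewrite inE adj_neq.
left; split; last exact/eqP.
apply/esym/parent_eq => //.
apply: (component_adj (ecomp_component e (single_subtree u)) (x := parent e v)).
- by apply: ecomp_compat Ck; apply: single_subtree_sub; rewrite !inE eqxx.
- by rewrite adj_sym parent_adj.
- by rewrite inE eq_sym adj_neq.
Qed.

Lemma parent_parent_neq e u : parent e (parent e u) <> u.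
Proof. by have [[]|[]] := parent_adjP e (parent_adj e u). Qed.

Lemma adj_parent e u v : adj u v -> v = parent e u \/ u = parent e v.
Proof. by move/(parent_adjP e) => [] []; [left|right]. Qed.

(** Along an edge one of the endpoints is the parent of the other, so having a
    common ancestor propagates along walks. *)
Lemma common_ancestor e u v : exists i j,
  iter i (parent e) u = iter j (parent e) v.
Proof.
apply: (@joined_ind T (fun v => exists i j,
  iter i (parent e) u = iter j (parent e) v)
  setT u v) (joinedT u v); first by exists 0, 0.
move=> x y _ _ xy [i [j ij]]; have [->|xE] := adj_parent e xy.
  by exists i.+1, j; rewrite -iterSr /= ij.
by exists i, j.+1; rewrite iterSr -xE.
Qed.

(** Otherwise the parents would run through a cycle of the tree; the periods 1
    and 2 are excluded separately. *)
Lemma iter_parent_neq e u n : iter n.+1 (parent e) u <> u.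
Proof.
have path_traject f x m : (forall y, adj y (f y)) ->
  path (@adj T) x (traject f (f x) m).
  by move=> H; elim: m x => //= m IH x; rewrite H IH.
elim/ltn_ind: n u => n IH u nu.
have us : uniq (traject (parent e) u n.+1).
  rewrite looping_uniq; apply/negP => /loopingP/(_ n)/trajectP[i ilt Hi].
  apply: (IH (n - i).-1 _ (iter i (parent e) u)).
    by rewrite prednK ?subn_gt0 // leq_subr.
  by rewrite prednK ?subn_gt0 // -iterD subnK // ltnW.
have := @tree_acyclic T (traject (parent e) u n.+1).
rewrite size_traject => H; have : n.+1 < 3.
  apply: H; apply/andP; split=> //=.
  rewrite rcons_path; apply/andP; split.
    by rewrite path_traject // => y; exact: parent_adj.
  rewrite last_traject; have := parent_adj e (iter n (parent e) u).
  by rewrite -iterS nu.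
case: n nu {IH us H} => [|[|//]] /= nu _; last exact: parent_parent_neq nu.
by have := adj_neq (parent_adj e u); rewrite nu eqxx.
Qed.

Lemma iter_parent_inj e u : injective (fun n => iter n (parent e) u).
Proof.
move=> m n; wlog mn : m n / m <= n.
  by move=> H; case: (leqP m n) => [/H //|/ltnW nm E]; rewrite (H n m).
rewrite -(subnK mn) iterD; case: (n - m) => [//|k] H.
by case: (@iter_parent_neq e (iter m (parent e) u) k).
Qed.

(** If the parent of x were in K, then x, being in the component of e, would
    in turn be the parent of its parent. *)
Lemma ecomp_parent_closed e K x : ecomp e K x -> ecomp e K (parent e x).
Proof.
move=> Cx; apply: (component_adj (ecomp_component e K) Cx (parent_adj e x)).
apply/negP => pK; apply: (@parent_parent_neq e x); apply: parent_eq.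
  by rewrite adj_sym parent_adj.
exact: (ecomp_compat (single_subtree_sub pK)) Cx.
Qed.

Lemma ecomp_iter_parent e K x n : ecomp e K x ->
  ecomp e K (iter n (parent e) x).
Proof. by move=> Cx; elim: n => //= n; exact: ecomp_parent_closed. Qed.

(** Some k in K has its parent in the component of e, which the parents never
    leave; and any u eventually follows the parents of k. *)
Lemma iter_parent_cvg e u : cvg_end (fun n => iter n (parent e) u) e.
Proof.
move=> K; have [k kK Ck] := ecomp_touch e K.
have [i [j ij]] := common_ancestor e (parent e k) u.
exists j => // n /= jn; rewrite -(subnK jn) iterD -ij -iterD.
exact: ecomp_iter_parent.
Qed.

Lemma iter_parent_ray e u : is_ray u e (fun n => iter n (parent e) u).
Proof.
split=> //; [|exact: iter_parent_inj|exact: iter_parent_cvg].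
by move=> i /=; exact: parent_adj.
Qed.

(** After a step from a parent to a child, the only way not to descend further
    would be to turn back. *)
Lemma away_forever e w m i : (forall j, j < m -> adj (w j) (w j.+1)) ->
  (forall j, j.+1 < m -> w j <> w j.+2) ->
  w i = parent e (w i.+1) -> forall j, i <= j < m -> w j = parent e (w j.+1).
Proof.
move=> wA wI wi j /andP[ij]; rewrite -(subnKC ij).
elim: (j - i) => [|k IH]; first by rewrite addn0.
rewrite addnS => km; have E := IH (ltnW km).
have [H|//] := adj_parent e (wA _ km).
by case: (wI _ km); rewrite E H.
Qed.

Lemma injective_no_backtrack w : injective w -> forall j, w j <> w j.+2.
Proof. by move=> wi j /wi /eqP; rewrite -addn2 -{1}[j]addn0 eqn_add2l. Qed.

(** A walk that once moves away from e stays below the vertex it left, hence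
    outside of the component of e. *)
Lemma ray_unique e u w : is_ray u e w -> w = (fun n => iter n (parent e) u).
Proof.
move=> [w0 wA wI wC].
have step i : w i.+1 = parent e (w i).
  have [//|wi] := adj_parent e (wA i).
  have [n _ /= Hn] := wC (single_subtree (w i)).
  have Cn : ecomp e (single_subtree (w i)) (w (i.+1 + n))
    by apply: Hn; rewrite /= leq_addl.
  have Ci : ecomp e (single_subtree (w i)) (w i.+1).
    elim: n Cn {Hn} => [|n IH]; first by rewrite addn0.
    rewrite addnS => Cn; apply: IH.
    apply: (component_adj (ecomp_component _ _) Cn).
      by rewrite adj_sym.
    rewrite inE; apply/eqP => /wI /eqP; apply/negP.
    by rewrite addSnnS -{2}[i]addn0 eqn_add2l.
  by rewrite (parent_eq (wA i) Ci).
by apply/funext; elim=> //= n IH; rewrite step IH.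
Qed.

Lemma rayE e u : ray u e = (fun n => iter n (parent e) u).
Proof.
apply: (@ray_unique e u); apply: (@xgetPex _ _ [set w | is_ray u e w]).
by exists (fun n => iter n (parent e) u); exact: iter_parent_ray.
Qed.

Lemma tend_eq e e' : (forall K, ecomp e K = ecomp e' K) -> e = e'.
Proof.
case: e e' => c1 p1 q1 [c2 p2 q2] /= H.
have E : c1 = c2 by exact/funext.
subst c2; congr TEnd; exact: Prop_irrelevance.
Qed.

Lemma component_eq K (C C' : set T) x : is_component K C -> is_component K C' ->
  C x -> C' x -> C = C'.
Proof.
move=> KC KC' Cx C'x; apply/seteqP; split=> y.
  by move/(componentP y KC Cx)/(componentP y KC' C'x).
by move/(componentP y KC' C'x)/(componentP y KC Cx).
Qed.

Lemma cvg_end_unique w e e' : cvg_end w e -> cvg_end w e' -> e = e'.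
Proof.
move=> we we'; apply: tend_eq => K.
have [n _ Hn] := we K; have [m _ Hm] := we' K.
apply: (@component_eq K _ _ (w (n + m))); try exact: ecomp_component.
- by apply: Hn; rewrite /= leq_addr.
- by apply: Hm; rewrite /= leq_addl.
Qed.

(** An injective sequence visits each of the finitely many elements of A at
    most once. *)
Lemma injective_avoid w (A : {fset T}) : injective w ->
  exists n, forall i, n <= i -> w i \notin A.
Proof.
move=> wI; elim/finSet_rect: A => A IH.
have [[i iA]|H] := pselect (exists i, w i \in A); last first.
  by exists 0 => i _; apply/negP => iA; apply: H; exists i.
have [n Hn] := IH (A `\ w i)%fset (fproperD1 iA).
exists (maxn n i.+1) => j; rewrite geq_max => /andP[/Hn + ij].
rewrite !inE negb_and negbK => /orP[/eqP/wI E|//].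
by rewrite E ltnn in ij.
Qed.

Lemma consecutive_comp w K n m : consecutive w ->
  (forall i, n <= i -> w i \notin (K : {fset T})) -> n <= m ->
  joined [set x | x \notin (K : {fset T})] (w n) (w m).
Proof.
move=> wA wK nm; rewrite -(subnKC nm); elim: (m - n) => [|k IH].
  by rewrite addn0; apply: joined_refl; exact: wK.
apply: (joined_trans IH); apply: joined_adj; rewrite ?addnS //=.
- by apply: wK; rewrite leq_addr.
- by apply: wK; rewrite leqW // leq_addr.
Qed.

(** After its last visit to K the walk stays in a single component; these
    components form an end. *)
Lemma end_of_walk w : consecutive w -> injective w -> exists e, cvg_end w e.
Proof.
move=> wA wI; pose N (K : subtree T) := sval (cid (injective_avoid K wI)).
have NP K i : N K <= i -> w i \notin (K : {fset T}).
  exact: (svalP (cid (injective_avoid K wI))).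
pose C (K : subtree T) := joined [set x | x \notin (K : {fset T})] (w (N K)).
have CK K : is_component K (C K) by exists (w (N K)) => //; exact: NP.
have Cw K i : N K <= i -> C K (w i)
  by apply: consecutive_comp => // j; exact: NP.
have CC K K' : (K `<=` K')%fset -> C K' `<=` C K.
  move=> KK' x; pose n := maxn (N K) (N K').
  have H' : C K' (w n) by apply: Cw; exact: leq_maxr.
  move/(componentP x (CK K') H') => nx.
  apply/(componentP x (CK K) (Cw K n (leq_maxl _ _))).
  apply: joined_sub nx => y /=; apply: contra; exact: (fsubsetP KK').
by exists (TEnd CK CC) => K; exists (N K) => // i /= /(Cw K).
Qed.

End Ends.

(** * Local surjectivity of branched coverings *)

Section LocalSurjectivity.
Local Open Scope ring_scope.
Variables (R : realType).

Lemma sum_delta (T : choiceType) (P : set T) (v : T) :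
  P v -> \sum_(u \in P) ((u == v)%:R : R) = 1.
Proof.
move=> Pv; rewrite (fsbigE [:: v]) //=.
- by rewrite big_cons big_nil mem_set // eqxx addr0.
- by move=> u /=; rewrite inE => /eqP ->.
- by move=> i _; rewrite inE => /negPf ->.
Qed.

Lemma delta_realization (T : tree) (v : T) :
  realization R T (fun u => (u == v)%:R).
Proof.
split=> [u|u w|]; first by rewrite ler0n.
- by rewrite !pnatr_eq0 !eqb0 !negbK => /eqP -> /eqP ->; left.
- exact: sum_delta.
Qed.

Lemma realize_delta (T1 T2 : tree) (F : T1 -> T2) (v : T1) :
  realize R T1 T2 F (fun u => (u == v)%:R) = (fun w => (w == F v)%:R).
Proof.
apply/funext => w; rewrite /realize; case: eqVneq => [->|wv].
  exact: sum_delta.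
apply: fsbig1 => u /= uw; case: eqVneq => // uv.
by rewrite -uw uv eqxx in wv.
Qed.

(** By openness, the points of the edge from F v to b that are close to F v
    have a preimage close to v, and such a preimage lies on an edge at v that
    is mapped onto this edge. *)
Lemma branched_covering_surj (T1 T2 : tree) (F : T1 -> T2) :
  branched_covering R T1 T2 F ->
  forall v b, adj (F v) b -> exists2 w, adj v w & F w = b.
Proof.
move=> bc v b vb.
pose U : set {ptws T1 -> R} := [set x : {ptws T1 -> R} | 2^-1 < x v].
have oU : open U.
  pose pv : {ptws T1 -> R} -> R := @proj T1 (fun=> R) v.
  apply: (@open_comp _ _ pv [set r | 2^-1 < r]).
    by move=> x _; exact: proj_continuous.
  exact: open_gt.
have [W oW imU] := bc_open bc oU.
(* The point of the edge from F v to b with weight 1/(n+2) at b. *)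
pose y (n : nat) : {ptws T2 -> R} := fun w =>
  if w == F v then 1 - n.+2%:R^-1 else if w == b then n.+2%:R^-1 else 0.
have bv : b == F v = false by apply/negbTE; rewrite eq_sym adj_neq.
have y_cvg : y @ \oo --> ((fun w => (w == F v)%:R) : {ptws T2 -> R}).
  have h0 : (fun n => n.+2%:R^-1) @ \oo --> (0 : R).
    by have := @cvg_harmonic R; rewrite -(cvg_shiftS); apply.
  apply/(@pointwise_cvgP (discrete_topology T2) R (y @ \oo)) => w.
  change ((fun n => y n w) @ \oo --> ((w == F v)%:R : R)); rewrite /y.
  case: (w == F v) => /=.
    rewrite -[X in _ --> X]subr0; apply: cvgB => //; exact: cvg_cst.
  by case: (w == b) => //; exact: cvg_cst.
have Wv : W (fun w => (w == F v)%:R).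
  suff [] : (realization R T2 `&` W) (fun w => (w == F v)%:R) by [].
  rewrite -imU; exists (fun u => (u == v)%:R); last exact: realize_delta.
  by split; [exact: delta_realization|rewrite /U /= eqxx invf_lt1 ?ltr1n
    ?ltr0n].
have [n _ /(_ n (leqnn n)) /= Wyn] := y_cvg _ (open_nbhs_nbhs (conj oW Wv)).
have yn : (realization R T2 `&` W) (y n).
  split=> //; split.
  - move=> w; rewrite /y; case: ifP => _; last by case: ifP; rewrite ?invr_ge0.
    by rewrite subr_ge0 invf_le1 ?ler1n ?ltr0n.
  - move=> u w; rewrite /y; case: (eqVneq u (F v)) => [->|_].
      case: (eqVneq w (F v)) => [->|_]; first by left.
      by case: (eqVneq w b) => [->|_]; rewrite ?eqxx //; right.
    case: (eqVneq u b) => [->|_]; rewrite ?eqxx // => _.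
    case: (eqVneq w (F v)) => [->|_]; first by right; rewrite adj_sym.
    by case: (eqVneq w b) => [->|_]; rewrite ?eqxx //; left.
  - rewrite (fsbigE [:: F v; b]) //=.
    + rewrite !big_cons big_nil !mem_set // /y eqxx bv eqxx addr0.
      by rewrite subrK.
    + by rewrite inE eq_sym bv.
    + by move=> u _; rewrite !inE negb_or /y => /andP[/negPf -> /negPf ->].
rewrite -imU in yn; case: yn => x [[x_ge0 x_supp _] xU] xyn.
have [u [Fu xu]] : exists u, F u = b /\ x u != 0.
  apply: contrapT => H.
  have : y n b = 0.
    rewrite -xyn; apply: fsbig1 => u /= Fu; apply/eqP/negPn/negP => xu.
    by apply: H; exists u.
  by rewrite /y bv eqxx => /eqP; rewrite invr_eq0 pnatr_eq0.
have xv : x v != 0.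
  by apply: contraTneq xU => x0; apply/negP;
    rewrite /U /= x0 ltNge invr_ge0 ler0n.
have [uv|vu] := x_supp _ _ xv xu; last by exists u.
by move: vb; rewrite uv Fu => vb; have := adj_irr b; rewrite vb.
Qed.

End LocalSurjectivity.

(** * Edges over a given edge *)

Section EdgeFibres.
Variables (T1 T2 : tree) (F : T1 -> T2) (de : T1 -> T1 -> nat) (a b : T2).
Hypothesis de_pos : forall v w, adj v w -> 0 < de v w.
Hypothesis deg3 : edge_degree F de a b = 3.

Let A := [set e : T1 * T1 | [/\ adj e.1 e.2, F e.1 = a & F e.2 = b]].

(** The degree of an infinite fibre would be 0, the value of a sum with
    infinite support. *)
Lemma edge_fibre_finite : finite_set A.
Proof.
apply: contrapT => infA; have : edge_degree F de a b = 0; last by rewrite deg3.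
apply: fsbig_dflt; suff -> : A `&` (fun e => de e.1 e.2) @^-1` [set~ 0%R] = A
  by [].
apply/seteqP; split=> [e []|e Ae] //; split=> //=.
by case: Ae => /de_pos + _ _; case: (de _ _).
Qed.

Lemma edge_fibre_sum : \sum_(e <- fset_set A) de e.1 e.2 = 3.
Proof.
by rewrite -deg3 /edge_degree fsbig_finite //; exact: edge_fibre_finite.
Qed.

Lemma edge_fibre_le3 (r : seq (T1 * T1)) : uniq r ->
  (forall e, e \in r -> A e) -> size r <= 3.
Proof.
move=> ur rA; rewrite -edge_fibre_sum.
apply: (@leq_trans (size (fset_set A))).
  apply: uniq_leq_size => // e /rA Ae.
  by rewrite in_fset_set ?inE //; exact: edge_fibre_finite.
rewrite -sum1_size big_seq [X in _ <= X]big_seq; apply: leq_sum => e.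
rewrite in_fset_set ?inE; last exact: edge_fibre_finite.
by case=> /de_pos.
Qed.

Lemma edge_fibre_ex : exists e, A e.
Proof.
apply: contrapT => H; have := edge_fibre_sum.
rewrite big_seq big1 // => e; rewrite in_fset_set ?inE => [Ae|].
  by case: H; exists e.
exact: edge_fibre_finite.
Qed.

End EdgeFibres.

(** * Trees rooted at an end *)

Section Children.
Variables (T : tree) (e : tend T).
Implicit Types (u v x y c : T).
Local Notation up := (parent e).

Definition children (v : T) : {fset T} := (nbr v `\ up v)%fset.

Lemma in_children v c : (c \in children v) = (up c == v).
Proof.
rewrite /children !inE; apply/andP/eqP => [[cv vc]|<-].
  by have [E|//] := adj_parent e vc; rewrite E eqxx in cv.
split; first by apply/negP => /eqP/esym/(@parent_parent_neq T e).
by have := parent_adj e c; rewrite adj_sym.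
Qed.

Lemma valence_children v : valence v = #|` children v|.+1.
Proof.
by rewrite /valence (cardfsD1 (up v)) (parent_adj e v : _ \in nbr v).
Qed.

Lemma nbr_children v : nbr v = (up v |` children v)%fset.
Proof. by rewrite fsetD1K // (parent_adj e v : _ \in nbr v). Qed.

Lemma valence2_child v x y : valence v = 2 -> up x = v -> up y = v -> x = y.
Proof.
rewrite valence_children => -[/eqP/cardfs1P[z chE]] /eqP + /eqP.
by rewrite -!in_children chE !inE => /eqP -> /eqP ->.
Qed.

(** A sequence of successive children is an injective walk; it cannot converge
    to e, because the only ray to e is ascending. *)
Lemma descending_ray w : (forall j, up (w j.+1) = w j) ->
  [/\ consecutive w, injective w, forall i j, iter j up (w (i + j)) = w i &
     exists2 e', is_ray (w 0) e' w & e' <> e].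
Proof.
move=> wd; have wA : consecutive w.
  by move=> j; rewrite adj_sym -[X in adj _ X]wd parent_adj.
have wi i j : iter j up (w (i + j)) = w i.
  by elim: j => [|j IH]; rewrite ?addn0 // addnS iterSr wd.
have wI : injective w.
  move=> i j ij; have := wi 0 i; rewrite add0n ij -[X in _ = X](wi 0 j) add0n.
  exact: (@iter_parent_inj T e (w j) i j).
split=> //; have [e' we'] := end_of_walk wA wI.
exists e'; first by split.
move=> E; have wr : is_ray (w 0) e w by split=> //; rewrite -E.
apply: (@parent_parent_neq T e (w 0)); rewrite -{2}(wd 0); congr (up _).
by rewrite (ray_unique wr).
Qed.

Hypothesis valence_neq_1 : forall v : T, valence v <> 1.

Lemma child_ex v : exists c, up c = v.
Proof.
have : children v != fset0.
  apply/eqP => ch0; apply: (@valence_neq_1 v).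
  by rewrite valence_children ch0 cardfs0.
by move/fset0Pn => [c]; rewrite in_children => /eqP <-; exists c.
Qed.

Definition some_child v : T := xget v [set c | up c = v].

Lemma some_childK v : up (some_child v) = v.
Proof. exact: (xgetPex v (child_ex v)). Qed.

(** Let C be the component of the isolated end e for a suitable K, and k the
    last vertex of K on the way to e. A second child of an ancestor of k in C
    has no descendant in K, so that by descending from it one reaches another
    end with the same component C. *)
Lemma isolated_valence2 : isolated_end e ->
  exists k, forall i, valence (iter i.+2 up k) = 2.
Proof.
move=> [K KP]; have [k kK Ck] := ecomp_touch e K; exists k => i.
rewrite valence_children; congr S; set b := iter i.+2 up k.
have Cb : ecomp e K b by rewrite /b iterSr; exact: ecomp_iter_parent.
have bK := componentN (ecomp_component e K) Cb.
suff -> : children b = [fset (iter i.+1 up k)]%fset by rewrite cardfs1.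
apply/fsetP => c; rewrite in_children inE; apply/eqP/eqP => [cb|-> //].
apply: contrapT => ck.
have cK y n : iter n up y = c -> y \notin (K : {fset T}).
  move=> yc; apply/negP => yK.
  have [] := @joined_exit T [set` (K : {fset T})]
    [set z | ~ exists n, iter n up z = c] k y _ _ (subtree_connected kK yK).
  - move=> [m mc]; apply: ck.
    have /(iter_parent_inj) E : iter m.+1 up k = iter i.+2 up k
      by rewrite /= mc.
    by rewrite -mc; case: E => ->.
  - by apply; exists n.
  move=> z [z' [zK z'K zz' /contrapT[m mc] /joined_endr[_ nz]]].
  have [E|E] := adj_parent e zz'; first
    by apply: nz; exists m.+1; rewrite iterSr -E.
  case: m mc => [|m] mc; last by apply: nz; exists m; rewrite E -iterSr.
  by move/negP: bK; apply; rewrite -cb -mc -E.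
have Cw n : ecomp e K (iter n some_child c).
  have wc m : iter m up (iter m some_child c) = c.
    by elim: m => // m IH; rewrite iterSr /= some_childK.
  elim: n => /= [|n IH].
    apply: (component_adj (ecomp_component e K) Cb); last exact: (cK _ 0).
    by rewrite adj_sym -cb parent_adj.
  apply: (component_adj (ecomp_component e K) IH);
    last exact: (cK _ n.+1 (wc _)).
  by rewrite adj_sym -{2}(some_childK (iter n some_child c)) parent_adj.
have [_ _ _ [e' [_ _ _ we'] e'e]] :=
  @descending_ray (fun n => iter n some_child c)
  (fun n => some_childK _).
apply: e'e; apply: KP; have [n _ /(_ n (leqnn n)) /= Hn] := we' K.
exact: (component_eq (ecomp_component e' K) (ecomp_component e K) Hn (Cw n)).
Qed.

(** An end with the same component as e in the complement of u has to follow
    the same ray, as there is no other way. *)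
Lemma valence2_isolated u : (forall i, valence (iter i up u) = 2) ->
  isolated_end e.
Proof.
move=> u2; exists (single_subtree u) => e' e'K.
have u1 : parent e' u = up u.
  apply/esym/parent_eq; first exact: parent_adj.
  by rewrite -e'K; exact: ecomp_parent.
have step i : iter i (parent e') u = iter i up u /\
              iter i.+1 (parent e') u = iter i.+1 up u.
  elim: i => [|i [IH IH']]; first by rewrite /= u1.
  split=> //; rewrite iterS IH' [RHS]iterS.
  have [//|E] := adj_parent e (parent_adj e' (iter i.+1 up u)).
  have E' : parent e' (iter i.+1 up u) = iter i up u.
    exact: (valence2_child (u2 i.+1) (esym E)).
  by have := @parent_parent_neq T e' (iter i up u);
    rewrite -{1}IH -iterS IH' E'.
apply: (@cvg_end_unique T (fun i => iter i up u)); last exact: iter_parent_cvg.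
rewrite (_ : (fun i => iter i up u) = (fun i => iter i (parent e') u)).
  exact: iter_parent_cvg.
by apply/funext => i; case: (step i).
Qed.

(** The ray from u merges with the one of [isolated_valence2], so that only
    finitely many ancestors of u have valence 3 or more; the last one is
    suitable. *)
Lemma top_branch_ex u : isolated_end e -> 3 <= valence u ->
  exists o, 3 <= valence o /\ forall i, valence (iter i.+1 up o) = 2.
Proof.
move=> /isolated_valence2[k k2] u3.
have [i [j ij]] := common_ancestor e u k.
pose P := fun n => 3 <= valence (iter n up u).
have Pb n : P n -> n <= i + 2.
  move=> Pn; rewrite leqNgt; apply/negP => in2; move: Pn; rewrite /P.
  have -> : iter n up u = iter (n - i + j - 2).+2 up k.
    have -> : (n - i + j - 2).+2 = n - i + j by lia.
    by rewrite iterD -ij -iterD subnK //; lia.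
  by rewrite k2.
have [n Pn nmax] := ex_maxnP (ex_intro P 0 u3) Pb.
exists (iter n up u); split=> // m.
have : ~~ P (m.+1 + n) by apply/negP => /nmax; lia.
rewrite /P iterD; have := @valence_neq_1 (iter m.+1 up (iter n up u)).
by rewrite valence_children; lia.
Qed.

End Children.
(* Keeps rewriting with inE from unfolding membership, for which
   in_children is the right description. *)
#[global] Opaque children.

(** * The highest branch vertex *)

Section Base.
Variables (T : tree) (e : tend T) (o : T).
Implicit Types (u v x y c : T).
Local Notation up := (parent e).
Hypothesis o3 : 3 <= valence o.
Hypothesis o2 : forall i, valence (iter i.+1 up o) = 2.

Lemma up_o_child i x : up x = iter i.+1 up o -> x = iter i up o.
Proof. by move=> xo; apply: (valence2_child (o2 i) xo). Qed.

(** Follow x and o up to their common ancestor; above o there is only one way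
    down. *)
Lemma above_or_below x : (exists i, x = iter i.+1 up o) \/ (exists n,
  iter n up x = o).
Proof.
have [n [j]] := common_ancestor e x o; elim: n j => [|n IH] j nj.
  by case: j nj => [|j] nj; [right; exists 0|left; exists j].
case: j nj => [|j] nj; first by right; exists n.+1.
exact: (IH j (up_o_child nj)).
Qed.

Lemma depth_uniq x n m : iter n up x = o -> iter m up x = o -> n = m.
Proof. by move=> no mo; apply: (@iter_parent_inj T e x); rewrite /= no mo. Qed.

Lemma base_ray x : 3 <= valence x -> exists n, iter n up x = o.
Proof. by have [[i ->]|//] := above_or_below x; rewrite o2. Qed.

Lemma top_branch_uniq o' : 3 <= valence o' ->
  (forall u, 3 <= valence u -> exists i, iter i up u = o') -> o' = o.
Proof.
move=> o'3 /(_ o o3)[[|i] io //].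
by move: o'3; rewrite -io o2.
Qed.

End Base.

(** * The dynamics preserves the direction of infinity *)

Lemma four_indices (P : nat -> Prop) : (forall m, exists2 i, m <= i & P i) ->
  exists s : seq nat, [/\ uniq s, size s = 4 & forall i, i \in s -> P i].
Proof.
move=> H; suff /(_ 4)[s [us _ ss sP]] n : exists s : seq nat,
    [/\ uniq s, exists m, forall i, i \in s ->
      i < m, size s = n & forall i, i \in s -> P i].
  by exists s.
elim: n => [|n [s [us [m sm] ss sP]]]; first
  by exists [::]; split=> //; exists 0.
have [i mi Pi] := H m; exists (i :: s); split; rewrite /= ?ss //.
- by rewrite us andbT; apply/negP => /sm; lia.
- exists i.+1 => j; rewrite inE => /orP[/eqP ->|/sm]; lia.
- by move=> j; rewrite inE => /orP[/eqP ->|/sP].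
Qed.

Section Dynamics.
Local Open Scope nat_scope.
Variables (R : realType) (T : metrized_tree R).
Hypothesis deg3 : global_degree T = 3.
Implicit Types (u v x y z c : T).
Local Notation up := (parent (inf_end T)).
Local Notation F := (@dyn R T).
Local Notation o := (base T).

Lemma dyn_adj x y : adj x y -> adj (F x) (F y).
Proof. exact: (bc_simplicial (dyn_bc T)). Qed.

Lemma dyn_surj x y : adj (F x) y -> exists2 w, adj x w & F w = y.
Proof. exact: (branched_covering_surj (dyn_bc T)). Qed.

Lemma edge_degree3 (a b : T) : adj a b -> edge_degree F edeg a b = 3.
Proof.
move: deg3; rewrite /global_degree; case: xgetP => // n -> H n3 ab.
by rewrite H.
Qed.

Lemma edeg_gt0 x y : adj x y -> 0 < edeg x y.
Proof. exact: (de_gt0 (degP T)). Qed.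

Lemma valence_neq_1 x : valence x <> 1. Proof. exact: valence_neq1. Qed.

Lemma inf_isolated : isolated_end (inf_end T).
Proof. exact/inf_endP. Qed.

(** The base is defined through rays; what is used of it is that it has
    valence at least 3 and that its ancestors have valence 2. *)
Fact base_spec : 3 <= valence o /\ forall i, valence (iter i.+1 up o) = 2.
Proof.
have [w _ w3] := grand_orbitP (point : T).
have [b [b3 b2]] := top_branch_ex (@valence_neq_1) inf_isolated w3.
suff -> : o = b by [].
have [b3' oP] : is_base (base T).
  apply: (@xgetI _ _ [set v | is_base v] b); split=> // u u3; rewrite rayE;
    exact: (base_ray b2).
by apply: (top_branch_uniq b3 b2) => // u /oP; rewrite rayE.
Qed.

Lemma base_valence : 3 <= valence o. Proof. by have [] := base_spec. Qed.
Lemma valence_above i : valence (iter i.+1 up o) = 2.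
Proof. by have [] := base_spec. Qed.

Local Notation v i := (iter i up o).

Lemma above_inj i j : v i = v j -> i = j. Proof. exact: iter_parent_inj. Qed.

Lemma above_adj i : adj (v i) (v i.+1). Proof. exact: parent_adj. Qed.

Lemma nbr_above i x : adj (v i.+1) x -> x = v i.+2 \/ x = v i.
Proof.
move=> /(adj_parent (inf_end T))[->|/esym]; first by left.
by move/(up_o_child valence_above); right.
Qed.

(** A walk without backtracking can be lifted downwards: the neighbour of c
    over d is not the parent of c, which lies over a. *)
Lemma lift_step c a b d : F (up c) = a -> F c = b -> adj b d -> a <> d ->
  exists2 c', up c' = c & F c' = d.
Proof.
move=> Fa Fb bd ad; have [w cw Fw] : exists2 w, adj c w & F w = d.
  by apply: dyn_surj; rewrite Fb.
have [E|] := adj_parent (inf_end T) cw; last by exists w.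
by case: ad; rewrite -Fa -E.
Qed.

Lemma lift_down n c : F c = v n -> F (up c) = v n.+1 ->
  exists z m, [/\ iter m up z = c, F z = v 0 & F (up z) = v 1].
Proof.
elim: n c => [|n IH] c Fc Fuc; first by exists c, 0.
have [|/above_inj/eqP|c' uc' Fc'] := lift_step Fuc Fc (d := v n).
- by rewrite adj_sym above_adj.
- by lia.
have [||z [m [zc' z0 z1]]] := IH c'; rewrite ?uc' //.
by exists z, m.+1; rewrite /= zc'.
Qed.

Lemma lift_up n J c : F c = v n.+1 -> F (up c) = v n ->
  exists z m, [/\ iter m up z = c, F z = v (n + J).+1 & F (up z) = v (n + J)].
Proof.
elim: J n c => [|J IH] n c Fc Fuc; first by exists c, 0; rewrite addn0.
have [|/above_inj/eqP|c' uc' Fc'] := lift_step Fuc Fc (d := v n.+2).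
- exact: above_adj.
- by lia.
have [||z [m [zc' z0 z1]]] := IH n.+1 c'; rewrite ?uc' //.
by exists z, m.+1; rewrite addnS -addSn /= zc'.
Qed.

(** A lift x of the ray that descends would converge to an end other than
    infinity, which is therefore not isolated; so infinitely many x i have a
    second child c. This c lies over the predecessor or over the successor of
    the image of x i. Infinitely many of the first kind give infinitely many
    edges over [v0, v1] below them, and four of the second kind give four
    edges over a common edge [v_J, v_(J+1)], while an edge has at most three
    preimages. *)
Lemma no_descending_lift (x : nat -> T) j : (forall i, up (x i.+1) = x i) ->
  ~ (forall i, F (x i) = v (j + i)).
Proof.
move=> xd xF; have [_ _ xi [e' xr e'i]] := descending_ray xd.
have xE i : x i = iter i (parent e') (x 0) by rewrite {1}(ray_unique xr).
pose Br i c := up c = x i /\ c <> x i.+1.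
have BrE m : exists2 i, m <= i & exists c, Br i c.
  apply: contrapT => H; apply: e'i; apply/inf_endP.
  apply: (@valence2_isolated T e' (x m)) => i.
  rewrite xE -iterD -xE (valence_children (inf_end T)); congr S.
  suff -> : children (inf_end T) (x (i + m)) = [fset (x (i + m).+1)]%fset.
    by rewrite cardfs1.
  apply/fsetP => c; rewrite in_children inE; apply/eqP/eqP => [cb|-> //].
  apply: contrapT => cx; apply: H; exists (i + m); first by rewrite leq_addl.
  by exists c.
have Br_disj i i' c c' m m' z : i < i' -> Br i c -> Br i' c' ->
    iter m up z = c -> iter m' up z = c' -> False.
  move=> ii' [cx cn] [c'x _] zc zc'; apply: cn.
  have E : iter (i' - i + m').+1 up z = x i.
    rewrite iterS iterD zc'; case E : (i' - i) => [|k]; first by lia.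
    rewrite iterSr c'x (_ : i' = i.+1 + k); last by lia.
    by rewrite xi.
  have : iter m.+1 up z = x i by rewrite /= zc.
  rewrite -E => /iter_parent_inj [mE]; rewrite -zc mE iterD zc'.
  case Ek : (i' - i) => [|k]; first by lia.
  by rewrite iterSr c'x (_ : i' = i.+1 + k); [rewrite xi|lia].
have no4 (a b : T) (s : seq nat) : adj a b -> uniq s -> size s = 4 ->
    (forall i, i \in s -> exists c z m,
      [/\ Br i c, iter m up z = c, F z = a & F (up z) = b]) ->
    False.
  move=> ab us s4 sP.
  pose P i := [set z | exists c m,
    [/\ Br i c, iter m up z = c, F z = a & F (up z) = b]].
  pose f i := xget point (P i).
  have fP i : i \in s -> P i (f i).
    by move/sP => [c [z [m H]]]; apply: (@xgetI _ _ (P i) z); exists c, m.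
  have := @edge_fibre_le3 T T F edeg a b edeg_gt0 (edge_degree3 ab)
     [seq (f i, up (f i)) | i <- s].
  rewrite size_map s4 => H; suff : 4 <= 3 by [].
  apply: H.
  - rewrite map_inj_in_uniq // =>
      i i' /fP[c [m [B1 m1 _ _]]] /fP[c' [m' [B2 m2 _ _]]] [E _].
    have [ii'|ii'|//] := ltngtP i i'.
    - by case: (Br_disj _ _ _ _ _ _ (f i) ii' B1 B2 m1
        (etrans (congr1 (iter m' up) E) m2)).
    - by case: (Br_disj _ _ _ _ _ _ (f i') ii' B2 B1 m2
        (etrans (congr1 (iter m up) (esym E)) m1)).
  - by move=> _ /mapP[i /fP[c [m [_ _ za zb]]] ->]; split=> //=;
      exact: parent_adj.
have [BD|] := pselect (forall m, exists2 i, m <= i & exists2 c, Br i c &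
  F c = v (j + i).-1 /\ 0 < j + i).
  have [s [us s4 sP]] := four_indices BD.
  apply: (@no4 (v 0) (v 1) s (above_adj 0) us s4) => i /sP[c Bc [Fc ji]].
  have [|z [m [zc z0 z1]]] := lift_down Fc.
    by case: Bc => -> _; rewrite xF prednK.
  by exists c, z, m.
move=> nBD; have [m0 Hm0] : exists m0, forall i c, m0 <= i -> Br i c ->
  F c = v (j + i).+1.
  apply: contrapT => H; apply: nBD => m; apply: contrapT => H'; apply: H.
  exists m.+1 => i c mi Bc; have : adj (F (x i)) (F c).
    by apply: dyn_adj; case: Bc => <- _; rewrite adj_sym parent_adj.
  rewrite xF; case E : (j + i) => [|q]; first by lia.
  case/nbr_above => // Fc; case: H'; exists i; first by lia.
  by exists c => //; rewrite E.
have BU m : exists2 i, m <= i & exists2 c, Br i c & F c = v (j + i).+1.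
  have [i mi [c Bc]] := BrE (maxn m m0); move: mi;
    rewrite geq_max => /andP[mi m0i].
  by exists i => //; exists c => //; exact: Hm0.
have [s [us s4 sP]] := four_indices BU.
(* High enough for the four branches to contain an edge over [v_J,
   v_(J+1)]. *)
pose J := \max_(i <- s) (j + i).
apply: (@no4 (v J.+1) (v J) s _ us s4); first by rewrite adj_sym above_adj.
move=> i si; have [c Bc Fc] := sP i si.
have iJ : j + i <= J by rewrite /J;
  exact: (@leq_bigmax_seq _ _ xpredT (fun i => j + i)).
have [|z [m [zc]]] := @lift_up (j + i) (J - (j + i)) c Fc.
  by case: Bc => -> _; rewrite xF.
by rewrite subnKC // => z0 z1; exists c, z, m.
Qed.

(** A child over the next vertex of the ray could be continued to a descending
    lift of the ray. *)
Lemma ray_no_child x c n : F x = v n -> up c = x -> F c <> v n.+1.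
Proof.
move=> Fx cx Fc; pose st y := xget y [set z | up z = y /\ F z = up (F y)].
pose w i := if i is i'.+1 then iter i' st c else x.
have wP i : [/\ up (w i.+1) = w i, F (w i) = v (n + i) &
  F (w i.+1) = v (n + i.+1)].
  elim: i => [|i [wu wF wF']]; first by rewrite /w /= addn0 addn1.
  suff [E1 E2] : up (w i.+2) = w i.+1 /\ F (w i.+2) = up (F (w i.+1)).
    by split=> //; rewrite E2 wF' !addnS.
  apply: (@xgetPex _ _ [set z | up z = w i.+1 /\ F z = up (F (w i.+1))]).
  have [||||z zw zF] := @lift_step (w i.+1) (v (n + i)) (v (n + i.+1))
    (v (n + i.+2)).
  - by rewrite wu.
  - by [].
  - by rewrite !addnS; exact: above_adj.
  - by move/above_inj; lia.
  by exists z; split=> //; rewrite zF wF' !addnS.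
apply: (@no_descending_lift w n) => i; by case: (wP i).
Qed.

(** Going on lifting the way to infinity from c, one reaches the ray, where
    the previous lemma applies. *)
Lemma child_not_up x c : up c = x -> F c <> up (F x).
Proof.
move=> cx; have [[i E]|[n]] := above_or_below valence_above (F x).
  by rewrite E; exact: ray_no_child E cx.
elim: n x c cx => [|n IH] x c cx Fx Fc.
  by have := @ray_no_child x c 0 Fx cx; rewrite Fc /= -Fx.
have [||||z zw zF] := @lift_step c (F x) (up (F x)) (up (up (F x))).
- by rewrite cx.
- by [].
- exact: parent_adj.
- by move/esym; exact: parent_parent_neq.
by apply: (IH c z zw); rewrite ?Fc // -iterSr.
Qed.

(** Some neighbour of x lies over the parent of F x, and it is not a child. *)
Lemma dyn_up x : F (up x) = up (F x).
Proof.
have [w xw Fw] := dyn_surj (parent_adj (inf_end T) (F x)).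
have [<- //|xE] := adj_parent (inf_end T) xw.
by case: (child_not_up (esym xE)).
Qed.

Lemma dyn_iter_up n x : F (iter n up x) = iter n up (F x).
Proof. by elim: n => //= n <-; rewrite dyn_up. Qed.

Lemma dyn_child_surj x y : up y = F x -> exists2 c, up c = x & F c = y.
Proof.
move=> yx; have [|w xw Fw] := @dyn_surj x y; first
  by rewrite -yx adj_sym parent_adj.
have [E|->] := adj_parent (inf_end T) xw; last by exists w.
by case: (@parent_parent_neq T (inf_end T) (F x)); rewrite -dyn_up -E Fw.
Qed.

Lemma dist_up_gt0 x : (0 < dist x (up x))%R.
Proof.
have D := distP T; rewrite lt_neqAle; apply/andP; split.
  apply/eqP => /esym/(dist_eq0 D) E.
  by have := adj_neq (parent_adj (inf_end T) x); rewrite -E eqxx.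
have := dist_triangle D x (up x) x; rewrite (dist_sym D (up x)).
rewrite (proj2 (dist_eq0 D x x) erefl) => H.
by rewrite -(@pmulrn_lge0 _ _ 2) // mulr2n.
Qed.

Lemma dist_up_F x : dist (F x) (up (F x)) = (3 * dist x (up x))%R.
Proof. by rewrite -dyn_up (dist_dyn (distP T)) ?parent_adj // deg3. Qed.

(** A preimage x of the base lies below the base: if it were v_(i+1), its two
    neighbours could not cover the at least three neighbours of v0. Applying
    up until v0 is reached gives F v0 = v_n, and n = 0 would make F an
    isometry on the edge [v0, v1]. *)
Lemma dyn_base_ex : exists k, F o = v k.+1.
Proof.
have [[x y] [/= _ Fx _]] := edge_fibre_ex edeg_gt0 (edge_degree3 (above_adj 0)).
have [[i xi]|[n nx]] := above_or_below valence_above x.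
  have : valence o <= 2.
    rewrite /valence -(valence_above i) -xi /valence.
    rewrite (_ : nbr o = [fset F w | w in nbr x]%fset `&` nbr o)%fset.
      apply: leq_trans (fsubset_leq_card (fsubsetIl _ _)) _.
      exact: leq_imfset_card.
    apply/esym/fsetIidPr/fsubsetP => z oz; apply/imfsetP => /=.
    have [|w xw Fw] := @dyn_surj x z; first by rewrite Fx.
    by exists w.
  by rewrite leqNgt base_valence.
have : F o = v n by rewrite -{1}nx dyn_iter_up Fx.
case: n nx => [|n] nx; last by exists n.
move=> Fo; have := dist_up_F o; rewrite Fo /= => /eqP.
by rewrite -[X in X == _]mul1r (inj_eq (mulIf (lt0r_neq0 (dist_up_gt0 o))))
  (eqr_nat R 1 3).
Qed.

End Dynamics.

(** * Degrees and the image of the base *)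

Section Degrees.
Local Open Scope nat_scope.
Variables (R : realType) (T : metrized_tree R).
Hypothesis deg3 : global_degree T = 3.
Implicit Types (u v x y z c : T).
Local Notation up := (parent (inf_end T)).
Local Notation F := (@dyn R T).
Local Notation o := (base T).
Local Notation v i := (iter i up o).
Local Notation dv := (@vdeg R T).
Local Notation children := (children (inf_end T)).

Let dyn_up := dyn_up deg3.

Lemma up_notin_children x : up x \notin children x.
Proof. by rewrite in_children; apply/eqP; exact: parent_parent_neq. Qed.

Lemma big_nbr (G : T -> nat) x :
  \sum_(w <- nbr x) G w = G (up x) + \sum_(w <- children x) G w.
Proof.
by rewrite (nbr_children (inf_end T) x) big_fsetU1 //= up_notin_children.
Qed.

(** No child of x is mapped to the parent of F x, so the edge towards infinity
    is alone in its fibre at x. *)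
Lemma edeg_up x : edeg x (up x) = dv x.
Proof.
rewrite (dv_sum (degP T) (parent_adj (inf_end T) x)) big_mkcond big_nbr eqxx.
rewrite big_seq big1 ?addn0 // => c; rewrite in_children => /eqP cx.
by case: eqP => //; rewrite dyn_up; move/(child_not_up deg3 cx).
Qed.

Lemma edeg_down c : edeg (up c) c = dv c.
Proof.
have cu := parent_adj (inf_end T) c.
by rewrite -(edeg_up c) (de_sym (degP T)) // adj_sym.
Qed.

(** The edge towards infinity does not count, as it lies over the edge from F
    x towards infinity. *)
Lemma vdeg_fibre x y : up y = F x ->
  dv x = \sum_(c <- children x | F c == y) dv c.
Proof.
move=> yx; have [w wx Fw] := dyn_child_surj deg3 yx.
have xw : adj x w by rewrite adj_sym -wx parent_adj.
rewrite (dv_sum (degP T) xw) Fw big_mkcond big_nbr dyn_up -yx.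
case: eqP => [/parent_parent_neq //|_]; rewrite add0n -big_mkcond.
rewrite big_seq_cond [RHS]big_seq_cond; apply: eq_bigr => c.
by rewrite in_children => /andP[/eqP <- _]; rewrite edeg_down.
Qed.

Lemma excess_sum x : \sum_(w <- nbr x) (edeg x w - 1) =
  (dv x - 1) + \sum_(c <- children x) (dv c - 1).
Proof.
rewrite big_nbr edeg_up; congr addn; rewrite big_seq [RHS]big_seq.
by apply: eq_bigr => c; rewrite in_children => /eqP <-; rewrite edeg_down.
Qed.

Lemma vdeg_gt0 x : 0 < dv x. Proof. exact: (Defs.dv_gt0 (degP T)). Qed.

Lemma excess_le x : \sum_(c <- children x) (dv c - 1) <= dv x - 1.
Proof.
by have := dv_ge (degP T) x; rewrite excess_sum; have := vdeg_gt0 x; lia.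
Qed.

Lemma vmultE x : vmult x = dv x - 1 - \sum_(c <- children x) (dv c - 1).
Proof. by rewrite /vmult excess_sum; have := vdeg_gt0 x; lia. Qed.

Lemma excess_card (A : {fset T}) :
  \sum_(c <- A) dv c = \sum_(c <- A) (dv c - 1) + #|` A|.
Proof.
rewrite -sum1_size -big_split /=; apply: eq_bigr => c _.
by have := vdeg_gt0 c; lia.
Qed.

(** All children of x lie over the only child of F x, so their degrees add up
    to that of x and the multiplicity of x is their number minus 1. *)
Lemma branch_critical x : 3 <= valence x -> valence (F x) = 2 -> 0 < vmult x.
Proof.
move=> x3 Fx2; have [y yx] := child_ex (inf_end T) (@valence_neq_1 _ T) (F x).
have := vdeg_fibre yx; rewrite big_seq_cond.
rewrite (eq_bigl (fun c => c \in children x)); last first.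
  move=> c; case: (boolP (c \in children x)) => //=;
    rewrite in_children => /eqP cx.
  apply/eqP; apply: (valence2_child Fx2) yx.
  by rewrite -dyn_up cx.
rewrite -big_seq excess_card vmultE => ->.
by move: x3; rewrite (valence_children (inf_end T)); lia.
Qed.

Hypothesis crit_orbit :
  forall x y, 0 < vmult x -> 0 < vmult y -> same_grand_orbit F x y.

(** If F v0 = v_(k+1), then F adds k + 1 to the heights, so grand orbits
    preserve heights modulo k + 1. The grand orbit of v1 contains a branch
    vertex, and the last branch vertex along its forward orbit is critical, as
    v0 is. They have the same grand orbit, so that k + 1 divides 1. *)
Lemma dyn_base : F o = v 1.
Proof.
have [k Fo] := dyn_base_ex deg3.
have Fv a i : iter a F (v i) = v (i + a * k.+1).
  elim: a i => [|a IH] i; first by rewrite addn0.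
  rewrite iterSr (dyn_iter_up deg3) Fo -iterD IH; congr (v _); lia.
have [w [a [b [a0 b0 ab]]] w3] := grand_orbitP (v 1).
have bw2 : ~~ (3 <= valence (iter b F w)) by rewrite -ab Fv valence_above.
have [j [jb jw3 jw2]] : exists j, [/\ j < b, 3 <= valence (iter j F w)
    & ~~ (3 <= valence (iter j.+1 F w))].
  elim: b {b0 ab} bw2 => [|b IH]; first by rewrite w3.
  have [b3|nb3] := boolP (3 <= valence (iter b F w)) => H.
    by exists b; rewrite ltnSn b3 H.
  by have [j [jb j3 j2]] := IH nb3; exists j; rewrite ltnW.
have jw2' : valence (F (iter j F w)) = 2.
  move: jw2 (@valence_neq_1 _ T (iter j.+1 F w)) => /=.
  by rewrite (valence_children (inf_end T)); lia.
have o0 : 0 < vmult o.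
  by apply: branch_critical; rewrite ?base_valence // Fo valence_above.
have [p [q [p0 q0]]] := crit_orbit o0 (branch_critical jw3 jw2').
move/(congr1 (iter (b - j) F)); rewrite (Fv p 0) Fv -!iterD.
rewrite (_ : b - j + q + j = q + b); last by lia.
rewrite [RHS]iterD -ab !Fv => /above_inj.
case: k {Fv} Fo => [-> //|k Fo E]; exfalso; move: E.
rewrite add0n -!mulnDl -addnA -mulnDl; set m := p + _; set n := a + q.
case: (leqP m n) => mn; have := leq_mul mn (leqnn k.+2); rewrite ?mulSn; lia.
Qed.
End Degrees.

(** * The spine as the set of vertices of higher degree *)

Lemma in_fset_sep (T : choiceType) (A : {fset T}) (P : pred T) x :
  (x \in [fset c in A | P c]%fset) = (x \in A) && P x.
Proof. by rewrite !inE. Qed.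

Section Spine.
Local Open Scope nat_scope.
Variables (R : realType) (T : metrized_tree R).
Hypothesis deg3 : global_degree T = 3.
Implicit Types (u v x y z c : T).
Local Notation up := (parent (inf_end T)).
Local Notation F := (@dyn R T).
Local Notation o := (base T).
Local Notation v i := (iter i up o).
Local Notation dv := (@vdeg R T).
Local Notation children := (children (inf_end T)).
Hypothesis Fo : F o = up o.

Let dyn_up := dyn_up deg3.

Lemma dyn_above i : F (v i) = v i.+1.
Proof. by rewrite (dyn_iter_up deg3) Fo -iterSr. Qed.

Lemma depth_dyn n x : iter n.+1 up x = o -> iter n up (F x) = o.
Proof.
move=> nx; apply: (up_o_child (@valence_above _ T) (i := 0)).
by rewrite -iterS -(dyn_iter_up deg3) nx Fo.
Qed.

Lemma depth_iter_dyn m n x : iter (m + n) up x = o ->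
  iter n up (iter m F x) = o.
Proof.
elim: m x => //= m IH x mx; rewrite -iterS iterSr; apply: IH.
exact: depth_dyn.
Qed.

Lemma depth_unique x n m : iter n up x = o -> iter m up x = o -> n = m.
Proof. exact: depth_uniq. Qed.

Lemma not_above_depth n i : iter n up (v i.+1) <> o.
Proof. by rewrite -iterD addnS => /(@above_inj _ T _ 0). Qed.

(** The edge [v0, v1] is the only one over [v1, v2]. *)
Lemma vdeg_base : dv o = 3.
Proof.
rewrite -(edeg_up deg3) -(edge_degree3 deg3 (above_adj T 1)) /edge_degree.
rewrite (_ : [set e | _] = [set (o, up o)]) ?fsbig_set1 //.
apply/seteqP; split=> [[x y] /= [xy Fx Fy]|_ ->]; last first.
  by split; rewrite /= ?parent_adj // (dyn_above 0, dyn_above 1).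
have xo : x = o.
  have [[i xi]|[n nx]] := above_or_below (@valence_above _ T) x.
    by move: Fx; rewrite xi dyn_above => /(@above_inj _ T _ 1).
  have := dyn_iter_up deg3 n x; rewrite nx Fx (dyn_above 0) -iterSr =>
    /(@above_inj _ T 1 n.+1) [n0].
  by rewrite -nx -n0.
rewrite xo; congr pair; move: xy;
  rewrite xo => /(adj_parent (inf_end T))[->//|].
by move/esym/(child_not_up deg3); rewrite Fy (dyn_above 0).
Qed.

Lemma children_above i : children (v i.+1) = [fset (v i)]%fset.
Proof.
apply/fsetP => c; rewrite in_children !inE; apply/eqP/eqP => [|-> //].
exact: (up_o_child (@valence_above _ T)).
Qed.

Lemma vdeg_above i : dv (v i) = 3.
Proof.
elim: i => [|i IH]; first exact: vdeg_base.
rewrite (@vdeg_fibre _ _ deg3 _ (v i.+1)) ?dyn_above // children_above.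
by rewrite big_mkcond big_seq_fset1 dyn_above eqxx.
Qed.

Lemma vmult_above i : vmult (v i.+1) = 0.
Proof. by rewrite (vmultE deg3) children_above big_seq_fset1 !vdeg_above. Qed.

(** The value is x itself when x has no child of degree at least 2, so that
    the iterates only make sense as long as there is one. *)
Definition heavy_child x := xget x [set c | up c = x /\ 1 < dv c].
Definition spine_pt i := iter i heavy_child o.
(** The spine has a vertex of index i, that is, i is at most the level. *)
Definition has_spine i :=
  forall j, j < i -> exists2 c, up c = spine_pt j & 1 < dv c.

Lemma has_spine0 : has_spine 0. Proof. by []. Qed.

Lemma has_spineW i j : has_spine j -> i <= j -> has_spine i.
Proof. by move=> H ij k ki; apply: H; exact: leq_trans ij. Qed.

Lemma has_spineS i : has_spine i.+1 ->
  up (spine_pt i.+1) = spine_pt i /\ 1 < dv (spine_pt i.+1).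
Proof.
move=> /(_ i (ltnSn i))[c c1 c2].
by apply: (@xgetPex _ _ [set c | up c = spine_pt i /\ 1 < dv c]); exists c.
Qed.

Lemma has_spine_child i c : has_spine i -> up c = spine_pt i -> 1 < dv c ->
  has_spine i.+1.
Proof.
move=> si cs c1 j; rewrite ltnS leq_eqVlt => /orP[/eqP ->|/si //].
by exists c.
Qed.

Lemma iter_up_spine_pt i j : has_spine (i + j) ->
  iter j up (spine_pt (i + j)) = spine_pt i.
Proof.
elim: j => [|j IH]; first by rewrite addn0.
rewrite addnS => H; rewrite iterSr (proj1 (has_spineS H)); apply: IH.
exact: has_spineW H _.
Qed.

Lemma depth_spine_pt i : has_spine i -> iter i up (spine_pt i) = o.
Proof. exact: (@iter_up_spine_pt 0). Qed.

Lemma excess_two x c c' : up c = x -> up c' = x -> c != c' ->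
  (dv c - 1) + (dv c' - 1) <= \sum_(d <- children x) (dv d - 1).
Proof.
move=> cx c'x cc'; rewrite (big_fsetD1 c) ?in_children ?cx //= (big_fsetD1 c')
  //=.
  by rewrite addnA leq_addr.
by rewrite in_fsetD1 eq_sym cc' in_children c'x /=.
Qed.

Lemma child_base c : up c = o -> F c = o.
Proof. by move=> co; exact: (@depth_dyn 0). Qed.

Lemma sum_children_base : \sum_(c <- children o) dv c = 3.
Proof.
rewrite -vdeg_base (@vdeg_fibre _ _ deg3 _ o) // big_seq [RHS]big_seq_cond.
apply: eq_bigl => c; case: (boolP (c \in children o)) => //=.
by rewrite in_children => /eqP/child_base ->; rewrite eqxx.
Qed.

Lemma card_children_base : 2 <= #|` children o|.
Proof. by have := base_valence T; rewrite (valence_children (inf_end T)). Qed.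

Lemma excess_base : \sum_(c <- children o) (dv c - 1) <= 1.
Proof.
by have := sum_children_base; rewrite (excess_card deg3);
  have := card_children_base; lia.
Qed.

(** The children of a vertex of degree 2 have total excess at most 1. For the
    base, of degree 3, the same bound comes from the fact that it has at least
    two children, whose degrees add up to 3. *)
Lemma excess_spine i : has_spine i ->
  \sum_(c <- children (spine_pt i)) (dv c - 1) <= 1 /\
  forall c, up c = spine_pt i -> 1 < dv c -> dv c = 2 /\ c = spine_pt i.+1.
Proof.
elim: i => [|i IH] si.
  split=> [|c co c1]; first exact: excess_base.
  have s1 := has_spine_child si co c1; have [u1 d1] := has_spineS s1.
  have [cE|cn] := eqVneq c (spine_pt 1); last first.
    by have := @excess_two o _ _ co u1 cn; have := excess_base; lia.
  split=> //; have : c \in children o by rewrite in_children co.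
  by have := excess_base => /[swap] cin; rewrite (big_fsetD1 c) //=; lia.
have [u1 d1] := has_spineS si.
have [_ /(_ _ u1 d1)[d2 _]] := IH (has_spineW si (leqnSn i)).
have E : \sum_(c <- children (spine_pt i.+1)) (dv c - 1) <= 1.
  by have := excess_le deg3 (spine_pt i.+1); rewrite d2.
split=> // c co c1.
have s1 := has_spine_child si co c1; have [u2 d3] := has_spineS s1.
have [cE|cn] := eqVneq c (spine_pt i.+2); last first.
  by have := excess_two co u2 cn; move: E; lia.
split=> //; have : c \in children (spine_pt i.+1) by rewrite in_children co.
by move=> cin; move: E; rewrite (big_fsetD1 c) //=; lia.
Qed.

Lemma vdeg_spine_pt i : has_spine i.+1 -> dv (spine_pt i.+1) = 2.
Proof.
move=> si; have [u1 d1] := has_spineS si.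
by have [_ /(_ _ u1 d1)[]] := excess_spine (has_spineW si (leqnSn i)).
Qed.

Lemma vdeg_child_le c : dv c <= dv (up c).
Proof.
have := excess_le deg3 (up c); rewrite (big_fsetD1 c) ?in_children //=.
by have := vdeg_gt0 c; have := vdeg_gt0 (up c); lia.
Qed.

(** Degrees do not increase when going down, so all the ancestors below the
    base of a vertex of degree at least 2 have this property too. *)
Lemma spineP n x : iter n up x = o -> 1 < dv x -> has_spine n /\ x = spine_pt n.
Proof.
elim: n x => [|n IH] x nx x1; first by split.
have [|sn ux] := IH (up x) _ (leq_trans x1 (vdeg_child_le x)).
  by rewrite -iterSr.
split; first exact: has_spine_child sn ux x1.
by have [_ /(_ x ux x1)[]] := excess_spine sn.
Qed.

Lemma vdeg_depth n x : iter n up x = o ->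
  dv x = if `[< has_spine n /\ x = spine_pt n >] then
    (if n is 0 then 3 else 2) else 1.
Proof.
move=> nx; case: asboolP => [[sn xE]|H].
  by case: n {nx} sn xE => [_ ->|n sn ->];
    [exact: vdeg_base|exact: vdeg_spine_pt].
have := vdeg_gt0 x; case: (ltngtP 1 (dv x)) => // x1 _.
by case: H; exact: spineP nx x1.
Qed.

(** The degrees in the fibre add up to that of x and are all 1, except for the
    next vertex of the spine, of degree 2. *)
Lemma card_fibre n x y : iter n up x = o -> up y = F x ->
  #|` [fset c in children x | F c == y]%fset| =
  dv x - `[< [/\ has_spine n.+1, x = spine_pt n & y = F (spine_pt n.+1)] >].
Proof.
move=> nx yx; set A := [fset c in _ | _]%fset.
have AE : dv x = \sum_(c <- A) dv c by rewrite big_fset /= -vdeg_fibre.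
have one c : c \in A -> c <> spine_pt n.+1 \/ ~ has_spine n.+1 -> dv c = 1.
  rewrite in_fset_sep in_children => /andP[/eqP cx _] H.
  rewrite (@vdeg_depth n.+1 c); last by rewrite iterSr cx.
  by case: asboolP => // -[]; case: H.
have card1 (B : {fset T}) : (forall c, c \in B -> dv c = 1) ->
    \sum_(c <- B) dv c = #|` B|.
  move=> B1; rewrite -sum1_size big_seq [RHS]big_seq; exact: eq_bigr.
case: asboolP => [[sn xs ys]|H] /=.
  have sA : spine_pt n.+1 \in A by rewrite in_fset_sep in_children
    (proj1 (has_spineS sn)) xs ys !eqxx.
  rewrite AE (big_fsetD1 _ sA) /= vdeg_spine_pt // (cardfsD1 (spine_pt n.+1))
    sA.
  rewrite card1; first by set m := #|` _|; rewrite /= add1n add2n subn1.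
  by move=> c; rewrite in_fsetD1 => /andP[/eqP cs cA]; apply: one; [|left].
rewrite subn0 AE card1 // => c cA; apply: (one) => //.
apply: contrapT => /not_orP[/contrapT cs /contrapT sn]; apply: H.
move: cA; rewrite in_fset_sep in_children => /andP[/eqP cx /eqP cy].
by split; [exact: sn|rewrite -cx cs (proj1 (has_spineS sn))|rewrite -cy cs].
Qed.

(** Away from the spine the degree is 1, so that fibres are singletons. *)
Lemma off_spine_inj n x c c' : iter n up x = o ->
  ~ (has_spine n /\ x = spine_pt n) ->
  up c = x -> up c' = x -> F c = F c' -> c = c'.
Proof.
move=> nx nsp cx c'x cc'; have := @card_fibre n x (F c) nx.
rewrite -dyn_up cx => /(_ erefl); rewrite (vdeg_depth nx) asboolF //.
rewrite asboolF; last first.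
  by case=> sn xs _; apply: nsp; split=> //; exact: has_spineW sn _.
move=> /eqP/cardfs1P[z zE].
have : c \in [fset z]%fset by rewrite -zE in_fset_sep in_children cx !eqxx.
have : c' \in [fset z]%fset by rewrite -zE in_fset_sep in_children c'x cc'
  !eqxx.
by rewrite !inE => /eqP -> /eqP ->.
Qed.

Lemma vmult_base : vmult o = 2 - `[< has_spine 1 >].
Proof.
rewrite (vmultE deg3) vdeg_base; congr (_ - _).
have := sum_children_base; rewrite (excess_card deg3).
case: asboolP => [/has_spineS [u1 d1]|n1] /=.
  have := excess_base; have : spine_pt 1 \in children o
    by rewrite in_children u1.
  by move: (spine_pt 1) d1 => c d1 cin; rewrite (big_fsetD1 _ cin) /=; lia.
move=> _; rewrite big_seq big1 // => c; rewrite in_children => /eqP co.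
by rewrite (@vdeg_depth 1 c) // asboolF //; case.
Qed.

(** Below the base only vertices of degree 2 can be critical, and the excess
    is used up by the next vertex of the spine when there is one. *)
Lemma vmult_depth n x : 0 < n -> iter n up x = o -> 0 < vmult x ->
  [/\ has_spine n, x = spine_pt n & ~ has_spine n.+1].
Proof.
move=> n0 nx; rewrite (vmultE deg3) (vdeg_depth nx).
case: asboolP => [[sn xs]|] //; case: n n0 nx sn xs => // n _ nx sn xs.
move=> H; split=> // /has_spineS[u1 d1]; move: H u1 d1;
  move: (spine_pt n.+2) => c H cx c1.
by move: H; rewrite (big_fsetD1 c) ?in_children ?cx ?xs //=; lia.
Qed.

Lemma vmult_tip n : 0 < n -> has_spine n -> ~ has_spine n.+1 ->
  vmult (spine_pt n) = 1.
Proof.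
move=> n0 sn nsn; rewrite (vmultE deg3) (vdeg_depth (depth_spine_pt sn))
  asboolT //.
case: n n0 sn nsn => // n _ sn nsn.
rewrite big_seq big1 // => c; rewrite in_children => /eqP cs.
have := vdeg_gt0 c; case: (ltngtP 1 (dv c)) => // [c1 _|<- //].
by case: nsn; exact: has_spine_child sn cs c1.
Qed.

End Spine.

(** * Distances to the Julia set *)

Section Heights.
Local Open Scope ring_scope.
Variables (R : realType) (T : metrized_tree R).
Hypothesis deg3 : global_degree T = 3%N.
Implicit Types (u v x y z c : T).
Local Notation up := (parent (inf_end T)).
Local Notation F := (@dyn R T).
Local Notation o := (base T).
Local Notation v i := (iter i up o).
Hypothesis Fo : F o = up o.
Local Notation lam0 := (dist o (up o)).

Let D := distP T.

(** From the base, a walk without backtracking either climbs the ray or starts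
    descending, and then goes on. *)
Lemma walk_from_base (w : nat -> T) m : w 0%N = o ->
  (forall j, (j < m)%N -> adj (w j) (w j.+1)) ->
  (forall j, (j.+1 < m)%N -> w j <> w j.+2) ->
  (forall j, (j <= m)%N -> w j = v j) \/
  (forall j, (j < m)%N -> up (w j.+1) = w j).
Proof.
move=> w0 wA wI; case: m wA wI => [|m] wA wI; first by right.
have := wA 0%N isT; rewrite w0 => /(adj_parent (inf_end T))[w1|w1].
  left; suff H j : ((j < m.+1)%N -> w j = v j /\ w j.+1 = v j.+1).
    by case=> [|j] jm //; case: (H j).
  elim: j => [|j IH] jm; first by rewrite w0 w1.
  have [wj wj1] := IH (ltnW jm); split=> //.
  have := wA _ jm; rewrite wj1 => /nbr_above[//|wj2].
  by case: (wI j) => //; rewrite wj wj2.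
right=> j jm; apply/esym; apply: (@away_forever T _ w m.+1 0) => //.
by rewrite w0.
Qed.

Lemma julia_ray (e : tend T) : e <> inf_end T ->
  forall i, up (iter i.+1 (parent e) o) = iter i (parent e) o.
Proof.
move=> ei i; have [_ wA wI wC] := iter_parent_ray e o.
set w := (fun n => iter n (parent e) o) in wA wI wC.
have H m := @walk_from_base w m erefl (fun j _ => wA j) (fun j _ =>
  injective_no_backtrack wI (j:=j)).
have [w1|w1] := H 1%N; last first.
  have [wv|wd] := H i.+1; last exact: (wd i).
  have : up (w 1%N) = o := w1 0%N isT.
  by rewrite (wv 1%N isT) => /parent_parent_neq.
case: ei; apply: (cvg_end_unique wC).
rewrite (_ : w = fun n => v n); first exact: iter_parent_cvg.
apply/funext => n; have [wv|wd] := H n.+1; first exact: wv.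
have : up (w 1%N) = o := wd 0%N isT.
by rewrite (w1 1%N isT) => /parent_parent_neq.
Qed.

Lemma julia_depth (e : tend T) : e <> inf_end T ->
  forall i, iter i up (iter i (parent e) o) = o.
Proof. by move=> ei; elim=> // i IH; rewrite iterSr julia_ray. Qed.

(** F maps the edge above x to the edge above F x, of smaller depth, and
    triples its length. *)
Lemma lam_depth n x : iter n up x = o -> dist x (up x) = lam0 / 3 ^+ n.
Proof.
elim: n x => [|n IH] x nx; first by rewrite expr0 divr1 -nx.
have := IH _ (depth_dyn deg3 Fo nx); rewrite (dist_up_F deg3) => E.
apply: (mulfI (_ : 3 != 0)); first by rewrite pnatr_eq0.
by rewrite E exprS; field; rewrite expf_neq0.
Qed.

Lemma dist_up_step n x :
  dist x (iter n.+1 up x) = dist x (up x) + dist (up x) (iter n.+1 up x).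
Proof.
pose p := traject up (up x) n.+1.
have lastp : last x p = iter n.+1 up x by exact: last_traject.
have pp : path (@adj T) x p.
  rewrite /p; elim: n.+1 x {lastp p} => //= m IH x.
  by rewrite (parent_adj (inf_end T) x : adj _ _) IH.
have up' : uniq (x :: p).
  rewrite -[x :: p]/(traject up x n.+2) looping_uniq.
  apply/negP => /loopingP/(_ n.+1)/trajectP[i ilt]
    /(@iter_parent_inj T (inf_end T) x).
  by lia.
by rewrite -lastp -(dist_path D pp up' (y := up x)) // inE mem_head orbT.
Qed.

Lemma dist_refl x : dist x x = 0.
Proof. exact: (proj2 (dist_eq0 D x x)). Qed.

Lemma dist_ge0 x y : 0 <= dist x y.
Proof.
have := dist_triangle D x y x; rewrite (dist_sym D y) dist_refl.
by rewrite -mulr2n pmulrn_lge0.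
Qed.

Lemma dist_depth n m x : iter (n + m) up x = o ->
  dist x (iter n up x) = lam0 / 2 * (3 ^- m - 3 ^- (n + m)).
Proof.
elim: n x => [|n IH] x nx; first by rewrite dist_refl subrr mulr0.
rewrite dist_up_step (lam_depth nx) iterSr IH; last by rewrite -iterSr.
by rewrite addSn exprS; field; rewrite !expf_neq0.
Qed.

Lemma lam0_gt0 : 0 < lam0. Proof. exact: dist_up_gt0. Qed.

(** Common bound on the steps of the sequences that define distances in the
    completion, so that these distances are limits. *)
Lemma approach_step (p : vpoint T) i :
  dist (approach p i) (approach p i.+1) <= lam0 / 3 ^+ i.+1.
Proof.
case: p => [x|[e ei]] /=.
  by rewrite dist_refl divr_ge0 ?exprn_ge0 // ltW // lam0_gt0.
rewrite rayE (dist_sym D) -(julia_ray (elimN eqP ei) i) (@lam_depth i.+1) //.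
by apply: julia_depth; exact/eqP.
Qed.

Lemma cvg_geo : (fun i : nat => 3 ^- i : R) @ \oo --> (0 : R).
Proof.
have := @cvg_expr R 3^-1; rewrite ger0_norm ?invr_ge0 // invf_lt1 ?ltr1n // =>
  /(_ isT).
by apply: cvg_trans; apply: near_eq_cvg; apply: nearW => i; rewrite exprVn.
Qed.

Lemma cvg_geoM (a : R) : (fun i : nat => a / 3 ^+ i) @ \oo --> (0 : R).
Proof. by rewrite -[X in _ --> X](mulr0 a); apply: cvgMr; exact: cvg_geo. Qed.

(** Adding the remaining length of the geometric series to the distances makes
    them nonincreasing, hence convergent. *)
Lemma cdist_cvg (p q : vpoint T) :
  (fun i => dist (approach p i) (approach q i)) @ \oo --> cdist p q.
Proof.
pose a i := dist (approach p i) (approach q i).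
(* The added term is twice the sum of lam0 / 3 ^+ k over k > i, which
   bounds what both sequences can still move. *)
pose b i := a i + lam0 / 3 ^+ i.
have b_cvg : cvgn b.
  apply: nonincreasing_is_cvgn.
    apply/nonincreasing_seqP => i; rewrite /b /a.
    have := dist_triangle D (approach p i.+1) (approach p i) (approach q i.+1).
    have := dist_triangle D (approach p i) (approach q i) (approach q i.+1).
    have := approach_step p i; have := approach_step q i.
    rewrite (dist_sym D (approach p i.+1) (approach p i)).
    have -> : lam0 / 3 ^+ i = 3 * (lam0 / 3 ^+ i.+1).
      by rewrite exprS; field; rewrite expf_neq0.
    by lra.
  exists 0 => _ [i _ <-]; rewrite addr_ge0 ?dist_ge0 //.
  by rewrite divr_ge0 ?exprn_ge0 // ltW // lam0_gt0.
have -> : cdist p q = lim (a @ \oo) by [].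
suff : cvgn a by [].
have -> : a = b \- (fun i => lam0 / 3 ^+ i).
  by apply/funext => i /=; rewrite /b addrK.
by apply: is_cvgB => //; apply: cvgP; exact: cvg_geoM.
Qed.

Lemma cdist_ge0 (p q : vpoint T) : 0 <= cdist p q.
Proof.
apply: (limr_ge (cvgP _ (@cdist_cvg p q))).
by apply: nearW => i; exact: dist_ge0.
Qed.

Lemma height_julia (p : julia T) : height (inr p) = 0.
Proof.
apply/eqP; rewrite eq_le; apply/andP; split; last first.
  apply: lb_le_inf; first by exists (cdist (inr p) (inr p)), p.
  by move=> _ [q _ <-]; exact: cdist_ge0.
apply: ge_inf.
  by exists 0 => _ [q _ <-]; exact: cdist_ge0.
exists p => //; apply: cvg_lim => //.
rewrite (_ : (fun _ => _) = fun=> 0); first exact: cvg_cst.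
by apply/funext => i; rewrite dist_refl.
Qed.

(** Go down from the base to x, then descend for ever. *)
Lemma julia_through n x : iter n up x = o ->
  exists p : julia T, forall k, approach (inr p) (n + k) =
    iter k (some_child (inf_end T)) x.
Proof.
move=> nx; pose w i := if (i <= n)%N then iter (n - i) up x
                      else iter (i - n) (some_child (inf_end T)) x.
have wd i : up (w i.+1) = w i.
  rewrite /w; case: (ltngtP i n) => [lt|lt|->].
  - by rewrite -iterS subnSK.
  - by rewrite subSn 1?ltnW //= some_childK //; exact: valence_neq_1.
  - by rewrite subSnn subnn /= some_childK //; exact: valence_neq_1.
have [_ _ _ [e er ei]] := descending_ray wd.
have ei' : e != inf_end T by apply/eqP.
have w0 : w 0%N = o by rewrite /w subn0.
have wE i : iter i (parent e) o = w i by rewrite (ray_unique er) w0.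
exists (exist _ e ei') => k; rewrite /= rayE wE /w; case: k => [|k].
  by rewrite addn0 leqnn subnn.
by rewrite ifF ?addKn //; apply/negbTE; rewrite -ltnNge addnS ltnS leq_addr.
Qed.

(** A Julia point below x is at distance lam0 / 2 / 3 ^ n, the sum of a
    geometric series; for any other one the triangle inequality with v0 shows
    that the distance is at least this value. *)
Lemma height_depth n x : iter n up x = o -> height (inl x) = lam0 / 2 / 3 ^+ n.
Proof.
move=> nx; apply/eqP; rewrite eq_le; apply/andP; split.
  have [p pE] := julia_through nx.
  apply: (@le_trans _ _ (cdist (inl x) (inr p))).
    apply: ge_inf; first by exists 0 => _ [q _ <-]; exact: cdist_ge0.
    by exists p.
  apply: (limr_le (cvgP _ (@cdist_cvg (inl x) (inr p)))).
  exists n => // i /= ni; rewrite -(subnKC ni) [X in dist _ X]pE.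
  set k := (i - n)%N.
  have kx : iter k up (iter k (some_child (inf_end T)) x) = x.
    elim: k => // k IH; rewrite iterSr /= some_childK //; exact: valence_neq_1.
  rewrite (dist_sym D) -{2}kx (@dist_depth k n); last first.
    by rewrite addnC iterD kx.
  apply: ler_wpM2l; first by rewrite divr_ge0 ?(ltW lam0_gt0).
  by rewrite lerBlDr lerDl invr_ge0 exprn_ge0.
apply: lb_le_inf.
  by have [p _] := julia_through nx; exists (cdist (inl x) (inr p)), p.
move=> _ [p _ <-].
have C := cvgD (@cdist_cvg (inl x) (inr p)) (@cvg_geoM (lam0 / 2)).
have {}C := C eventually_filter; rewrite addr0 in C; rewrite -(cvg_lim _ C) //.
apply: limr_ge; first exact: cvgP C.
apply: nearW => i /=; case: p {C} => e ei /=; rewrite rayE.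
set w := iter i (parent e) o.
have wi : iter i up w = o by apply: julia_depth; exact/eqP.
have := dist_triangle D w x o.
have := @dist_depth i 0 w; rewrite addn0 => /(_ wi).
have := @dist_depth n 0 x; rewrite addn0 => /(_ nx).
rewrite nx wi !expr0 invr1 (dist_sym D w x) => -> ->.
move=> tri; change (lam0 / 2 / 3 ^+ n <= dist x w + lam0 / 2 / 3 ^+ i).
move: tri; rewrite !mulrBr mulr1.
move: (_ / 3 ^+ n) (_ / 3 ^+ i) => a b; lra.
Qed.

End Heights.

(** * The level and the spine *)

Section Level.
Variables (R : realType) (T : metrized_tree R).
Hypothesis deg3 : global_degree T = 3%N.
Implicit Types (u v x y z c : T).
Local Notation up := (parent (inf_end T)).
Local Notation F := (@dyn R T).
Local Notation o := (base T).
Local Notation v i := (iter i up o).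
Local Notation dv := (@vdeg R T).
Local Notation spine_pt := (@spine_pt R T).
Local Notation has_spine := (@has_spine R T).
Hypothesis Fo : F o = up o.

(** The topology of nat is discrete. *)
Lemma cvg_nat_eq (f : nat -> nat) m : f @ \oo --> m ->
  exists n, forall i, n <= i -> f i = m.
Proof.
move=> fm; have [|n _ Hn] := fm [set m]; last by exists n.
by rewrite nbhs_principalE.
Qed.

(** Let q be the vertex of depth i on the way to p. The component of p in the
    complement of q consists of the descendants of the next vertex. *)
Lemma julia_eventually_below (p : julia T) (w : nat -> T) i :
  cvg_end w (val p) ->
  exists n, forall k, n <= k -> exists m,
    iter m up (w k) = iter i.+1 (parent (val p)) o.
Proof.
case: p => e ei /= we; set q := iter i (parent e) o.
have qd : up (iter i.+1 (parent e) o) = q by apply: julia_ray; exact/eqP.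
have [n _ Hn] := we (single_subtree q); exists n => k nk.
have Cq := ecomp_parent e q.
have := proj1 (componentP (w k) (ecomp_component e (single_subtree q)) Cq)
  (Hn k nk).
apply: (@joined_ind T (fun y => exists m,
  iter m up y = iter i.+1 (parent e) o)).
  by exists 0%N.
move=> x y xq yq xy [m mx]; have [yE|xE] := adj_parent (inf_end T) xy;
  last first.
  by exists m.+1; rewrite iterSr -xE.
case: m mx => [|m] mx; last by exists m; rewrite yE -iterSr.
by move: yq; rewrite /mkset yE (_ : x = iter i.+1 (parent e) o) // qd inE eqxx.
Qed.

Lemma vdeg_iter_up m x : dv x <= dv (iter m up x).
Proof.
elim: m => //= m IH; exact: leq_trans IH (vdeg_child_le deg3 _).
Qed.

(** Infinitely many vertices of degree at least 2 converge to p, hence every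
    vertex on the way to p has degree at least 2 and belongs to the spine. *)
Lemma jmult_gt0_spine (p : julia T) : 0 < jmult p ->
  (forall i, has_spine i) /\ forall i, spine_pt i = iter i (parent (val p)) o.
Proof.
rewrite /jmult; case: xgetP => // m -> [w [wA wC /cvg_nat_eq[n nw]]] m0.
have pi : val p <> inf_end T by exact/eqP/(valP p).
have H i : has_spine i.+1 /\ iter i.+1 (parent (val p)) o = spine_pt i.+1.
  apply: (spineP deg3) => //; first exact: julia_depth.
  have [k Hk] := julia_eventually_below i wC.
  have [j jE] := Hk (n + k) (leq_addl _ _).
  rewrite -jE; apply: leq_trans (vdeg_iter_up j _).
  by have := nw (n + k) (leq_addr _ _); lia.
by split=> -[|i] //; have [] := H i.
Qed.

(** Otherwise some walk to p would have only vertices of degree 1 from some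
    time on; but to pass from a vertex of depth d to the descendants of the
    vertex of depth d + 1 of the spine it must visit this vertex. *)
Lemma spine_jmult_gt0 (p : julia T) : (forall i, has_spine i) ->
  cvg_end spine_pt (val p) -> 0 < jmult p.
Proof.
move=> sl spp; have pi : val p <> inf_end T by exact/eqP/(valP p).
have spA : consecutive spine_pt.
  by move=> i; rewrite adj_sym -(proj1 (has_spineS (sl i.+1))) parent_adj.
have : exists m : nat, [set m : nat | exists w : nat -> T,
    [/\ consecutive w, cvg_end w (val p) &
      (fun i => dv (w i) - 1) @ \oo --> m]] m.
  exists 1%N; exists spine_pt; split=> //.
  apply: cvg_near_cst; exists 1%N => // -[//|i] _ /=.
  by rewrite (vdeg_spine_pt deg3).
move=> /(xgetPex 0%N)[w [wA wC /cvg_nat_eq[n nw]]].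
rewrite lt0n; apply/eqP => m0.
have {}nw k : n <= k -> dv (w k) = 1%N.
  by move=> /nw; rewrite -/(jmult p) m0; have := vdeg_gt0 (w k); lia.
have [[a wa]|[d wd]] := above_or_below (@valence_above _ T) (w n).
  by have := nw n (leqnn n); rewrite wa (vdeg_above deg3).
have q_spine_pt i : spine_pt i = iter i (parent (val p)) o.
  have H := @descending_ray _ _ spine_pt (fun i =>
    proj1 (has_spineS (sl i.+1))).
  case: H => _ spI _ _.
  have -> // : spine_pt = (fun i => iter i (parent (val p)) o).
  by apply: ray_unique; split.
have [k Hk] := julia_eventually_below d wC.
have nbelow j : n <= j -> ~ exists m, iter m up (w j) = spine_pt d.+1.
  move=> nj; rewrite -(subnKC nj); elim: (j - n) => [|a IH] [m mE].
    have : iter (d.+1 + m) up (w n) = o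
      by rewrite iterD -(addn0 n) mE depth_spine_pt.
    by move/(depth_unique wd); lia.
  apply: IH; have := wA (n + a); rewrite -addnS.
  move=> /(adj_parent (inf_end T))[E|E].
    by exists m.+1; rewrite iterSr -E.
  case: m mE => [|m] mE; last by exists m; move: mE; rewrite iterSr -E.
  by have := nw _ (leq_addr a.+1 n);
    rewrite (mE : w _ = _) (vdeg_spine_pt deg3).
apply: (nbelow (n + k) (leq_addr _ _)).
by have [m mE] := Hk _ (leq_addl n k); exists m; rewrite mE q_spine_pt.
Qed.

Lemma spine_pt_depth_inj i j : has_spine i -> has_spine j ->
  spine_pt i = spine_pt j -> i = j.
Proof.
by move=> si sj E; apply: (depth_unique (depth_spine_pt si));
  rewrite E depth_spine_pt.
Qed.

(** The heights are in the ratio 3 ^ n by [height_depth]. *)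
Lemma level_finite n : has_spine n -> other_crit T = inl (spine_pt n) ->
  level T = (n%:R)%:E.
Proof.
move=> sn oc; have l0 := lam0_gt0 T.
have hn := height_depth deg3 Fo (depth_spine_pt sn).
have h0 : height (inl o) = (dist o (up o) / 2)%R.
  by rewrite (@height_depth R T deg3 Fo 0) // expr0 divr1.
have hn0 : (0 < dist o (up o) / 2 / 3 ^+ n)%R by rewrite !divr_gt0 ?exprn_gt0.
rewrite /level oc hn h0 gt_eqF //; congr EFin.
have -> : (dist o (up o) / 2 / (dist o (up o) / 2 / 3 ^+ n) = 3 ^+ n)%R.
  by field; rewrite !gt_eqF ?exprn_gt0.
rewrite lnXn // -[(ln 3 *+ n)%R]mulr_natl mulfK // gt_eqF // ln_gt0 //.
by rewrite ltr1n.
Qed.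

Lemma level_infinite (p : julia T) : other_crit T = inr p -> level T = +oo%E.
Proof. by move=> oc; rewrite /level oc height_julia // eqxx. Qed.

Hypothesis hT : in_PT3_2 T \/ in_PT3_1 T.

Lemma vmult_gt0_tip x : x <> o -> 0 < vmult x ->
  exists n, [/\ has_spine n, x = spine_pt n & ~ has_spine n.+1].
Proof.
move=> xo x0; have [[i xi]|[[|n] nx]] := above_or_below (@valence_above _ T) x.
- by move: x0; rewrite xi (vmult_above deg3 Fo).
- by case: xo.
- by exists n.+1; apply: (vmult_depth deg3 Fo) nx x0.
Qed.

(** A critical vertex below the base is the last vertex of the spine, and a
    critical point of the Julia set is the end of an infinite spine. When the
    multiplicity of the base is 1, each of the two classes of trees provides
    another critical point. *)
Lemma other_crit_tip : (exists n,
  [/\ has_spine n, ~ has_spine n.+1 & other_crit T = inl (spine_pt n)]) \/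
  (forall i, has_spine i) /\ exists2 p : julia T, other_crit T = inr p &
    forall i, spine_pt i = iter i (parent (val p)) o.
Proof.
have [s1|ns1] := pselect (has_spine 1); last first.
  left; exists 0; split=> //; rewrite /other_crit (vmult_base deg3 Fo).
  by rewrite asboolF //=; apply: xget_unique.
have vo1 : vmult o = 1%N by rewrite (vmult_base deg3 Fo) asboolT.
set A := [set x : vpoint T | x <> inl o /\ (0 < mult x)%N].
have ocE : other_crit T = xget (inl o) A by rewrite /other_crit vo1.
have Ajul p : A (inr p) -> (forall i, has_spine i) /\ forall i,
  spine_pt i = iter i (parent (val p)) o.
  by move=> [_ p0]; exact: jmult_gt0_spine.
have Avert x : A (inl x) -> exists n,
  [/\ has_spine n, x = spine_pt n & ~ has_spine n.+1].
  by move=> [xo x0]; apply: vmult_gt0_tip => // E; apply: xo; rewrite E.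
suff [q Aq] : exists q : vpoint T, A q.
  have := xgetI (inl o) Aq; rewrite -ocE; case: (other_crit T) => [y|p] H.
    by left; have [n [sn -> nsn]] := Avert _ H; exists n.
  by right; have [sl spE] := Ajul _ H; split=> //; exists p.
case: hT => [[_ allv same]|[_ [u [p [u1 p1 all]]]]]; last first.
  by exists (inr p); split=> //=; rewrite p1.
have [H|/existsNP[n nsn]] := pselect (forall i, has_spine i).
  have [_ _ _ [e er ei]] := @descending_ray _ _ spine_pt (fun i =>
    proj1 (has_spineS (H i.+1))).
  have ei' : e != inf_end T by apply/eqP.
  have [_ _ _ ec] := er; pose p : julia T := exist _ e ei'.
  by have [|//] := allv (inr p); exact: spine_jmult_gt0.
have [m [sm nsm]] : exists m, has_spine m /\ ~ has_spine m.+1.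
  elim: n nsn => [[]//|n IH nsn]; have [sn|nsn'] := pselect (has_spine n);
    last exact: IH.
  by exists n.
have m0 : 0 < m by case: m {sm} nsm.
exists (inl (spine_pt m)); split=> /=.
  by case=> /(@spine_pt_depth_inj m 0 sm (@has_spine0 R T)); lia.
by rewrite (vmult_tip deg3 Fo).
Qed.

Lemma levelP i : (i%:R%:E <= level T)%E <-> has_spine i.
Proof.
have [[n [sn nsn oc]]|[sl [p oc _]]] := other_crit_tip; last first.
  by rewrite (level_infinite oc) leey; split.
rewrite (level_finite sn oc) lee_fin ler_nat; split=> [|si].
  exact: has_spineW.
by rewrite leqNgt; apply/negP => ni; apply: nsn; exact: has_spineW ni.
Qed.

Lemma is_spine_spine_pt : is_spine spine_pt.
Proof.
split=> //.
- by move=> i /levelP/has_spineS[<- _]; rewrite adj_sym parent_adj.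
- by move=> i j; rewrite !inE /= => /levelP si /levelP sj /spine_pt_depth_inj;
    apply.
- move=> l lE; have [[n [sn nsn oc]]|[sl [p oc _]]] := other_crit_tip.
    by move: lE; rewrite (level_finite sn oc) => -[/eqP];
      rewrite eqr_nat => /eqP <-.
  by move: lE; rewrite (level_infinite oc).
- move=> lE; have [[n [sn nsn oc]]|[sl [p oc spE]]] := other_crit_tip.
    by move: lE; rewrite (level_finite sn oc).
  exists p => //; rewrite (_ : spine_pt = fun n => iter n (parent (val p)) o).
    exact: iter_parent_cvg.
  by apply/funext.
Qed.

Lemma spineE i : has_spine i -> spine T i = spine_pt i.
Proof.
move=> si; have [s0 sA sI sfin sinf] : is_spine (spine T).
  exact: (xgetI (fun=> o) is_spine_spine_pt).
have [[n [sn nsn oc]]|[sl [p oc spE]]] := other_crit_tip; last first.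
  have [p' p'E scvg] := sinf (level_infinite oc).
  move: p'E; rewrite oc => -[E]; subst p'; rewrite spE.
  suff -> : spine T = fun n => iter n (parent (val p)) o by [].
  apply: ray_unique; split=> //; first by move=> j; apply: sA; apply/levelP.
  by move=> j k E; apply: sI => //; rewrite inE; apply/levelP.
have in_n : i <= n by rewrite leqNgt; apply/negP => ni; apply: nsn;
  exact: has_spineW ni.
have snE : spine T n = spine_pt n
  by have := sfin n (level_finite sn oc); rewrite oc => -[].
have sL j : j <= n -> j \in [set i | (i%:R%:E <= level T)%E].
  by move=> jn; rewrite inE; apply/levelP; exact: has_spineW sn jn.
have [||H|H] := @walk_from_base R T (spine T) n s0.
- by move=> j jn; apply: sA; apply/levelP; exact: has_spineW sn jn.
- move=> j jn E; have jn' : j <= n by lia.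
  by have := sI _ _ (sL j jn') (sL j.+2 jn) E; lia.
- have n0 : n = 0.
    have := depth_spine_pt sn; rewrite -snE (H n) //.
    by case: (n) => // m /not_above_depth.
  by move: in_n; rewrite n0 leqn0 => /eqP ->.
- suff E k : k <= n -> spine T (n - k) = spine_pt (n - k).
    by have := E (n - i) (leq_subr _ _); rewrite subKn.
  elim: k => [|k IH] kn; first by rewrite subn0.
  have nk : (n - k.+1).+1 = n - k by lia.
  rewrite -(H (n - k.+1)); last by lia.
  rewrite nk IH; last by lia.
  by rewrite -nk; apply: (proj1 (has_spineS (has_spineW sn _))); lia.
Qed.

End Level.

(** * Reading the code *)

Lemma leastP (A : set nat) : (exists n, A n) ->
  A (least A) /\ forall m, A m -> least A <= m.
Proof.
move=> [n An]; apply: (@xgetPex _ 0 [set n | A n /\ forall m, A m -> n <= m]).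
have E : exists n, `[< A n >] by exists n; apply/asboolP.
exists (ex_minn E); case: ex_minnP => m /asboolP Am mmin; split=> // k Ak.
by apply: mmin; apply/asboolP.
Qed.

Section Code.
Local Open Scope nat_scope.
Variables (R : realType) (T : metrized_tree R).
Hypothesis deg3 : global_degree T = 3.
Implicit Types (u v x y z c : T).
Local Notation up := (parent (inf_end T)).
Local Notation F := (@dyn R T).
Local Notation o := (base T).
Local Notation v i := (iter i up o).
Local Notation spine_pt := (@spine_pt R T).
Local Notation has_spine := (@has_spine R T).
Hypothesis Fo : F o = up o.
Hypothesis hT : in_PT3_2 T \/ in_PT3_1 T.

Let dyn_up := dyn_up deg3.

Lemma depth_orbit i j : has_spine i -> j <= i ->
  iter (i - j) up (iter j F (spine_pt i)) = o.
Proof.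
by move=> si ji; apply: (depth_iter_dyn deg3 Fo);
  rewrite subnKC // depth_spine_pt.
Qed.

Lemma iter_dyn_above i j : iter j F (v i) = v (i + j).
Proof.
elim: j => [|j IH]; first by rewrite addn0.
by rewrite iterS IH (dyn_above deg3 Fo) addnS.
Qed.

Lemma orbit_above i j : has_spine i -> i <= j ->
  iter j F (spine_pt i) = v (j - i).
Proof.
move=> si ij; rewrite -{1}(subnK ij) iterD.
have := depth_orbit si (leqnn i); rewrite subnn /= => ->.
exact: (iter_dyn_above 0).
Qed.

(** F raises the height by 1, so that s_i, of height -i, is mapped by F^j to a
    vertex of height j - i. *)
Lemma orbit_height i j i' j' : has_spine i -> has_spine i' ->
  iter j F (spine_pt i) = iter j' F (spine_pt i') -> i + j' = i' + j.
Proof.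
move=> si si'; case: (leqP j i) => ji; case: (leqP j' i') => ji' E.
- have := depth_orbit si ji; rewrite E => /(depth_unique (depth_orbit si' ji')).
  by lia.
- have := depth_orbit si ji; rewrite E orbit_above ?(ltnW ji') //.
  by case E' : (j' - i') => [|k]; [lia|move/not_above_depth].
- have := depth_orbit si' ji'; rewrite -E orbit_above ?(ltnW ji) //.
  by case E' : (j - i) => [|k]; [lia|move/not_above_depth].
- by move: E; rewrite !orbit_above ?(ltnW ji) ?(ltnW ji') // => /above_inj; lia.
Qed.

(** Since F commutes with up. *)
Lemma orbit_up n j : has_spine n.+1 ->
  up (iter j F (spine_pt n.+1)) = iter j F (spine_pt n).
Proof.
move=> sn; rewrite -(proj1 (has_spineS sn));
  elim: j (spine_pt n.+1) => //= j IH x.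
by rewrite -dyn_up IH.
Qed.

Lemma in_orbitP i x :
  in_orbit_of_spine i x <-> has_spine i /\ exists j, x = iter j F (spine_pt i).
Proof.
have L := levelP deg3 Fo hT; have S := spineE deg3 Fo hT.
split=> -[]; first by move/L => si [j ->]; split=> //; exists j; rewrite S.
by move=> si [j ->]; split; [apply/L|exists j; rewrite S].
Qed.

Lemma in_orbit_spine_pt i j : has_spine i ->
  in_orbit_of_spine i (iter j F (spine_pt i)).
Proof. by move=> si; apply/in_orbitP; split=> //; exists j. Qed.

Lemma in_orbit_dyn i j x : in_orbit_of_spine i x ->
  in_orbit_of_spine i (iter j F x).
Proof.
by move=> /in_orbitP[si [k ->]]; rewrite -iterD; exact: in_orbit_spine_pt.
Qed.

Lemma g_least x i : in_orbit_of_spine i x ->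
  in_orbit_of_spine (g x) x /\ g x <= i.
Proof.
move=> ix; have [] := @leastP [set i | in_orbit_of_spine i x]; first
  by exists i.
by move=> gx /(_ i ix).
Qed.

Lemma axisP x : axis x <-> (exists2 i, has_spine i &
  x = spine_pt i) \/ exists i, x = v i.
Proof.
have L := levelP deg3 Fo hT; have S := spineE deg3 Fo hT.
split=> -[[i H ->]|[i ->]]; rewrite ?rayE; try
  by right; exists i; rewrite ?rayE.
  by move/L : H => si; left; exists i; rewrite ?S.
by left; exists i; [apply/L|rewrite S].
Qed.

Lemma N_above i : N_set (v i).
Proof.
split; first by exists 0; rewrite -[v i](iter_dyn_above 0);
  apply: (in_orbit_spine_pt (i := 0)).
by exists (v i); [apply/axisP; right; exists i|left].
Qed.

(** A vertex of depth D + 1 is adjacent to the axis only through its parent,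
    or because it belongs to the spine itself, as does then its parent. *)
Lemma N_depth D x : S_set x -> iter D.+1 up x = o ->
  N_set x <-> has_spine D /\ up x = spine_pt D.
Proof.
move=> Sx xD; split=> [[_ [u /axisP uA ux]]|[sD xs]]; last first.
  split=> //; exists (spine_pt D); first by apply/axisP; left; exists D.
  by right; rewrite -xs adj_sym parent_adj.
have upD : iter D up (up x) = o by rewrite -iterSr.
case: uA => [[i si E]|[i E]]; subst u.
  case: ux => [E|/(adj_parent (inf_end T))[xE|E]].
  - have iD : D.+1 = i by apply: (depth_unique xD); rewrite -E depth_spine_pt.
    subst i; split; first exact: has_spineW si _.
    by rewrite -E (proj1 (has_spineS si)).
  - case: i si xE => [|i] si xE.
      by move: xD; rewrite xE => /(@not_above_depth _ _ D.+1 0).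
    have [E _] := has_spineS si; rewrite E in xE.
    have sD : has_spine i := has_spineW si (leqnSn i).
    have iD : D.+1 = i by apply: (depth_unique xD); rewrite xE depth_spine_pt.
    subst i; split; first exact: has_spineW sD _.
    by rewrite xE (proj1 (has_spineS sD)).
  - have iD : D = i by apply: (depth_unique upD); rewrite -E depth_spine_pt.
    by rewrite iD.
have H0 : up x = v i -> has_spine D /\ up x = spine_pt D.
  move=> E; move: upD; rewrite E; case: (i) => [|k]; last
    by move/not_above_depth.
  by case: (D) => // D' /(@not_above_depth _ _ 0 D').
case: ux => [E|/(adj_parent (inf_end T))[xE|/esym//]].
  move: xD; rewrite -E; case: (i) => [|k]; last by move/not_above_depth.
  by move/(@not_above_depth _ _ 0 D).
by move: xD; rewrite xE => /(@not_above_depth _ _ D.+1 i).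
Qed.

Section Step.
Variable n : nat.
Hypothesis sn : has_spine n.+1.
Let a k := iter k F (spine_pt n.+1).
Let merged x := exists2 i, i <= n & in_orbit_of_spine i x.
Let on_axis k := `[< iter k F (spine_pt n) = spine_pt (n - k) >].

Lemma orbit_S k : S_set (a k).
Proof. by exists n.+1; exact: in_orbit_spine_pt. Qed.

Lemma on_axis_N k : k <= n -> (on_axis k <-> N_set (a k)).
Proof.
move=> kn; have D : iter (n - k).+1 up (a k) = o.
  by rewrite -subSn //; apply: depth_orbit => //; exact: leqW.
rewrite (N_depth (orbit_S k) D) /a orbit_up // /on_axis.
split=> [/asboolP ->|[_ E]]; last exact/asboolP.
by split=> //; apply: has_spineW sn _; lia.
Qed.

(** After time n the orbit of s_(n+1) is on the ray above the base, which is
    the orbit of s_0. *)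
Lemma orbit_tail k : n < k -> merged (a k) /\ N_set (a k).
Proof.
move=> nk; rewrite /a orbit_above //; split; last exact: N_above.
exists 0 => //; rewrite -[v _](iter_dyn_above 0);
  exact: (in_orbit_spine_pt (i := 0)).
Qed.

Lemma merged_mono k l : k <= l -> merged (a k) -> merged (a l).
Proof.
move=> kl [i iN io]; exists i => //; rewrite /a -(subnK kl) iterD.
exact: in_orbit_dyn.
Qed.

Lemma start_not_merged : ~ merged (a 0).
Proof.
move=> [i iN /in_orbitP[si [j E]]].
by have := @orbit_height n.+1 0 i j sn si E; lia.
Qed.

Lemma g_new k : g (a k) = n.+1 <-> ~ merged (a k).
Proof.
have [go gn] := g_least (in_orbit_spine_pt k sn);
  split=> [E [i iN /g_least[_]]|nold].
  by rewrite E; lia.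
apply/eqP; rewrite eqn_leq gn ltnNge; apply/negP => gk.
by apply: nold; exists (g (a k)).
Qed.

Let fresh k := on_axis k && `[< ~ merged (a k) >].

(** A point of the orbit has g = n + 1 exactly when no earlier orbit contains
    it, and is in N exactly when its parent is on the spine; after time n it
    is on the orbit of v0. *)
Lemma lifetime_count : lifetime T n.+1 = count fresh (iota 0 n.+1).
Proof.
rewrite /lifetime -size_filter.
have aI : {in iota 0 n.+1 &, injective a}.
  by move=> k l _ _ /(orbit_height sn sn); lia.
pose r := seq.filter fresh (iota 0 n.+1); rewrite -/r.
have rP k : (k \in r) = fresh k && (k <= n).
  by rewrite mem_filter mem_iota add0n ltnS.
have rE x : (x \in [fset x in map a r]%fset) = (x \in map a r) by rewrite !inE.
rewrite (_ : [set v | _] = [set` [fset x in map a r]%fset]).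
  rewrite set_fsetK card_fseq undup_id ?size_map //.
  rewrite map_inj_in_uniq ?filter_uniq ?iota_uniq //.
  by move=> k l; rewrite !mem_filter => /andP[_ kn] /andP[_ ln]; exact: aI.
clearbody r; apply/seteqP; split=> x; rewrite /mkset rE.
  move=> [Nx gx]; have [i /g_least[]] : S_set x by case: Nx.
  rewrite gx => /in_orbitP[_ [k xE]] _; rewrite -/(a k) in xE; subst x.
  have nold : ~ merged (a k) by apply/g_new.
  have kn : k <= n by rewrite leqNgt; apply/negP => /orbit_tail[].
  apply/mapP; exists k => //; rewrite rP kn andbT.
  by apply/andP; split; [apply/on_axis_N|apply/asboolP].
move=> /mapP[k]; rewrite rP => /andP[/andP[kon]].
by move=> /asboolP nold kn ->; split; [apply/on_axis_N|apply/g_new].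
Qed.

(** Once the orbit has merged with an earlier one it remains so: the lifetime
    is the number of visits near the axis before merging. *)
Lemma merged_lifetime k : k <= n -> on_axis k ->
  merged (a k) <-> lifetime T n.+1 <= count on_axis (iota 0 k).
Proof.
move=> kn kon; rewrite lifetime_count; split=> [ko|].
  rewrite -(subnKC (leqW kn)) iotaD count_cat add0n.
  rewrite (_ : count fresh (iota k _) = 0) ?addn0.
    by apply: sub_count => l /andP[].
  apply/eqP; rewrite -leqn0 leqNgt -has_count; apply/hasPn => l.
  rewrite mem_iota => /andP[kl _]; rewrite /fresh negb_and orbC.
  by apply/orP; left; apply/asboolPn => H; apply: H; exact: merged_mono ko.
move=> ck; apply: contrapT => nold; move: ck; apply/negP; rewrite -ltnNge.
have nl l : l <= k -> on_axis l -> fresh l.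
  move=> lk lo; rewrite /fresh lo; apply/asboolP => H; apply: nold.
  exact: merged_mono H.
have -> : n.+1 = k.+1 + (n - k) by lia.
rewrite iotaD count_cat; apply: leq_trans (leq_addr _ _).
rewrite -[k.+1]addn1 iotaD count_cat /= add0n (nl k) // addn0 addn1 ltnS.
rewrite -!size_filter; apply: eq_leq; congr size; apply: eq_in_filter => l.
rewrite mem_iota add0n /= => lk; case: (boolP (on_axis l)) => [/nl -> //|];
  first exact: ltnW.
by rewrite /fresh => /negPf ->.
Qed.

Let ret k := least [set j | 0 < j /\ N_set (iter j F (a k))].

Lemma returnP k : [/\ 0 < ret k, N_set (a (k + ret k)) &
  forall j, k < j -> N_set (a j) -> k + ret k <= j].
Proof.
have aD j : iter j F (a k) = a (k + j) by rewrite /a addnC iterD.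
have [] := @leastP [set j | 0 < j /\ N_set (iter j F (a k))].
  exists n.+1; split=> //; rewrite aD.
  by have [] := @orbit_tail (k + n.+1) _; first by rewrite addnS ltnS leq_addl.
rewrite -/(ret k) => -[r0]; rewrite aD => rN rmin; split=> // j kj Nj.
have := rmin (j - k); rewrite /= aD subnKC ?(ltnW kj) // subn_gt0.
by move=> /(_ (conj kj Nj)); lia.
Qed.

(** The successive times at which the orbit of s_(n+1) is in N. *)
Fixpoint return_time j := if j is j'.+1 then return_time j' + ret
  (return_time j') else 0.

Lemma iter_return j : iter j (@first_return R T) (spine_pt n.+1) =
  a (return_time j).
Proof.
elim: j => //= j ->; rewrite /first_return -/(ret _) /a addnC iterD; congr iter.
Qed.

Lemma return_time_ge j : j <= return_time j.
Proof. by elim: j => //= j IH; have [] := returnP (return_time j); lia. Qed.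

(** No visit to N is missed by the first return map. *)
Lemma return_time_onto J k : N_set (a k) -> k < return_time J ->
  exists2 j, j < J & k = return_time j.
Proof.
elim: J => [//|J IH] Nk /=; case: (ltngtP k (return_time J)) => [lt|lt|->] kJ.
- by have [j jJ ->] := IH Nk lt; exists j => //; exact: ltnW.
- by have [_ _ /(_ k lt Nk)] := returnP (return_time J); lia.
- by exists J.
Qed.

(** The terminus is the value of g at the first visit near the axis after
    merging. All later points, and in particular the given one, are in the
    orbit of this visit. *)
Lemma terminusP k : k <= n -> on_axis k -> merged (a k) ->
  terminus T n.+1 <= n /\ exists j, a k = iter j F (spine_pt (terminus T n.+1)).
Proof.
move=> kn kon kold; rewrite /terminus (spineE deg3 Fo hT sn).
set A := [set j | _]; have [] := @leastP A.
  exists n.+1; split=> //; rewrite iter_return => /g_new; apply.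
  by have [] := orbit_tail (return_time_ge n.+1).
move: (least A) => J []; rewrite iter_return => J0 gJ Jmin.
have [go gn] : in_orbit_of_spine (g (a (return_time J))) (a (return_time J)) /\
  g (a (return_time J)) <= n.+1.
  exact: (g_least (in_orbit_spine_pt _ sn)).
split; first by move: gn; rewrite leq_eqVlt => /orP[/eqP|].
have Jk : return_time J <= k.
  rewrite leqNgt; apply/negP => kJ.
  have [[|j] jJ kE] := return_time_onto (proj1 (on_axis_N kn) kon) kJ.
    by apply: start_not_merged; rewrite -[0]/(return_time 0) -kE.
  have [gk|/eqP gk] := eqVneq (g (a k)) n.+1; first by move/g_new: gk; apply.
  have := Jmin j.+1; rewrite leqNgt jJ => H; suff : false by []; apply: H.
  by split=> //; rewrite iter_return -kE.
have := in_orbit_dyn (k - return_time J) go;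
  rewrite -iterD subnK // => /in_orbitP[_].
by [].
Qed.

End Step.

(** What the code says about the orbit of s_(n+1): at a time k when its parent
    orbit is on the spine, comparing the number c of earlier times of this
    kind with the lifetime tells whether it has merged with earlier orbits,
    and the terminus tells with which one. *)
Lemma code_step n k : has_spine n.+1 -> k <= n ->
  iter k F (spine_pt n) = spine_pt (n - k) ->
  let c := count (fun l => `[< iter l F (spine_pt n) = spine_pt (n - l) >])
    (iota 0 k) in
  (c < lifetime T n.+1 -> forall i j, i <= n ->
     iter k F (spine_pt n.+1) <> iter j F (spine_pt i)) /\
  (lifetime T n.+1 <= c -> terminus T n.+1 <= n /\
     exists j, iter k F (spine_pt n.+1) =
       iter j F (spine_pt (terminus T n.+1))).
Proof.
move=> sn kn kon c.
have kon' : `[< iter k F (spine_pt n) = spine_pt (n - k) >] by apply/asboolP.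
have [H1 H2] := merged_lifetime sn kn kon'.
split=> [ck i j iN E|ck]; last exact: terminusP (H2 ck).
have : lifetime T n.+1 <= c.
  apply: H1; exists i => //; rewrite E; apply: in_orbit_spine_pt.
  by apply: has_spineW sn _; exact: leqW.
by rewrite leqNgt ck.
Qed.

End Code.

(** * The code determines the orbits of the spine *)

Section Merge.
Local Open Scope nat_scope.
Variables (R : realType).
Implicit Types (T : metrized_tree R).
Local Notation up := (parent (inf_end _)).

Definition normalized T := [/\ global_degree T = 3,
  dyn (base T) = parent (inf_end T) (base T) & in_PT3_2 T \/ in_PT3_1 T].

(** In both classes two critical vertices are in the same grand orbit. *)
Lemma PT3_normalized T : in_PT3_2 T \/ in_PT3_1 T -> normalized T.
Proof.
move=> hT; have deg3 : global_degree T = 3 by case: hT => -[].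
split=> //; apply: (dyn_base deg3) => x y x0 y0;
  case: hT => [[_ _]|[_ [u [p [_ _ all]]]]].
  exact.
have uE z : 0 < vmult z -> z = u.
  by move=> /(all (inl z))[[]|].
by rewrite (uE x x0) (uE y y0); exists 1, 1.
Qed.

Definition orbits_agree T1 T2 n := forall i i' j j', i <= n -> i' <= n ->
  (iter j dyn (spine_pt T1 i) = iter j' dyn (spine_pt T1 i') <->
   iter j dyn (spine_pt T2 i) = iter j' dyn (spine_pt T2 i')).

Lemma orbits_agree_sym T1 T2 n : orbits_agree T1 T2 n -> orbits_agree T2 T1 n.
Proof. by move=> H i i' j j' iN iN'; split=> /(H i i' j j' iN iN'). Qed.

(** By induction on n + 1 - k. On the axis [code_step] reduces the question to
    the orbit of the terminus, an earlier index. Off the axis F is injective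
    on the children of the parent, so a coincidence is equivalent to one of
    the parents, of index n, and one of the images, at time k + 1. *)
Lemma orbits_agree_step T1 T2 n : normalized T1 -> normalized T2 ->
  has_spine T1 n.+1 -> has_spine T2 n.+1 ->
  lifetime T1 n.+1 = lifetime T2 n.+1 -> terminus T1 n.+1 = terminus T2 n.+1 ->
  orbits_agree T1 T2 n ->
  forall k i' j', i' <= n ->
    iter k dyn (spine_pt T1 n.+1) = iter j' dyn (spine_pt T1 i') ->
    iter k dyn (spine_pt T2 n.+1) = iter j' dyn (spine_pt T2 i').
Proof.
move=> [d1 F1 h1] [d2 F2 h2] s1 s2 lE tE IH.
have s1' i : i <= n -> has_spine T1 i
  by move=> iN; apply: has_spineW s1 (leqW iN).
have s2' i : i <= n -> has_spine T2 i
  by move=> iN; apply: has_spineW s2 (leqW iN).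
move=> k; move Em : (n.+1 - k) => m.
elim: m k Em => [|m IHm] k Em i' j' iN E.
  have H := orbit_height d1 F1 s1 (s1' i' iN) E.
  rewrite (orbit_above d2 F2) ?(orbit_above d2 F2) //; try lia; last exact: s2'.
  by congr iter; lia.
have kn : k <= n by lia.
have Hh := orbit_height d1 F1 s1 (s1' i' iN) E.
have on_eq l : l <= n -> iter l dyn (spine_pt T1 n) = spine_pt T1 (n - l) <->
    iter l dyn (spine_pt T2 n) = spine_pt T2 (n - l).
  by move=> ln; apply: (IH n (n - l) l 0) => //; exact: leq_subr.
have [on1|noff] := pselect (iter k dyn (spine_pt T1 n) = spine_pt T1 (n - k)).
  have on2 := proj1 (on_eq k kn) on1.
  have [A1 B1] := code_step d1 F1 h1 s1 kn on1.
  have [_ B2] := code_step d2 F2 h2 s2 kn on2.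
  set c1 := count _ _ in A1 B1; set c2 := count _ _ in B2.
  have c12 : c1 = c2.
    apply: eq_in_count => l; rewrite mem_iota add0n => /andP[_ lk].
    by apply: asbool_equiv_eq; apply: on_eq; lia.
  case: (ltnP c1 (lifetime T1 n.+1)) => [/A1 /(_ i' j' iN) //|lc].
  have [tn [j1 E1]] := B1 lc; rewrite lE c12 in lc.
  have [_ [j2 E2]] := B2 lc; rewrite -tE in E2.
  have j12 : j1 = j2.
    have := orbit_height d1 F1 s1 (s1' _ tn) E1.
    by have := orbit_height d2 F2 s2 (s2' _ tn) E2; lia.
  by rewrite E2 -j12; apply/(IH _ _ _ _ tn iN); rewrite -E1.
case: i' iN E Hh => [|i'] iN E Hh; first by lia.
have kE : iter k dyn (spine_pt T2 n) = iter j' dyn (spine_pt T2 i').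
  apply/(IH n i' k j' (leqnn n) (ltnW iN)).
  by rewrite -(orbit_up d1 k s1) E (orbit_up d1) //; exact: s1'.
have FE : iter k.+1 dyn (spine_pt T2 n.+1) = iter j'.+1 dyn (spine_pt T2 i'.+1).
  by apply: IHm; rewrite ?iterS ?E //; lia.
apply: (off_spine_inj d2 F2 (depth_orbit d2 F2 (s2' _ (leqnn n)) kn)) FE.
- by case=> _ /(on_eq k kn).
- exact: orbit_up.
- by rewrite kE; apply: orbit_up => //; exact: s2'.
Qed.

Lemma tree_codeE T i : normalized T -> tree_code T i.+1 =
  if `[< has_spine T i.+1 >] then Some (lifetime T i.+1,
    terminus T i.+1) else None.
Proof.
move=> [d F h]; rewrite /tree_code /=; congr (if _ then _ else _).
apply/idP/asboolP; [by move/(levelP d F h)|by move=> si; apply/(levelP d F h)].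
Qed.

(** The comparison of a new orbit with the earlier ones is [orbits_agree_step]
    in both directions; two points of the same orbit coincide only at equal
    times. *)
Lemma code_orbits_agree T1 T2 : normalized T1 -> normalized T2 ->
  (forall i, tree_code T1 i = tree_code T2 i) ->
  forall n, (has_spine T1 n <-> has_spine T2 n) /\
    (has_spine T1 n -> orbits_agree T1 T2 n).
Proof.
move=> N1 N2 hcode; have lenE n : has_spine T1 n <-> has_spine T2 n.
  case: n => [|n]; first by split.
  have := hcode n.+1; rewrite !tree_codeE //.
  by case: asboolP => H1; case: asboolP.
elim=> [|n [_ IH]]; split=> // s1.
  have [[d1 F1 _] [d2 F2 _]] := (N1, N2).
  move=> i i' j j'; rewrite !leqn0 => /eqP -> /eqP ->.
  have H1 k := @orbit_above R T1 d1 F1 0 k (@has_spine0 R T1) (leq0n k).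
  have H2 k := @orbit_above R T2 d2 F2 0 k (@has_spine0 R T2) (leq0n k).
  by split=> E; [move: (H1 j) (H1 j')|move: (H2 j) (H2 j')];
    rewrite E => -> /above_inj; rewrite !subn0 => ->.
have s2 : has_spine T2 n.+1 by apply/lenE.
have {}IH := IH (has_spineW s1 (leqnSn n)).
have [lE tE] : lifetime T1 n.+1 = lifetime T2 n.+1 /\
  terminus T1 n.+1 = terminus T2 n.+1.
  by have := hcode n.+1; rewrite !tree_codeE // !asboolT // => -[].
have new k i' j' : i' <= n -> iter k dyn (spine_pt T1 n.+1) =
  iter j' dyn (spine_pt T1 i') <->
    iter k dyn (spine_pt T2 n.+1) = iter j' dyn (spine_pt T2 i').
  move=> iN; split; first exact: orbits_agree_step.
  by apply: (orbits_agree_step N2 N1) => //; exact: orbits_agree_sym.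
have [[d1 F1 _] [d2 F2 _]] := (N1, N2).
move=> i i' j j'; rewrite leq_eqVlt ltnS => iN; rewrite leq_eqVlt ltnS => iN'.
case/orP: iN => [/eqP ->|iN]; case/orP: iN' => [/eqP ->|iN'].
- split=> E.
    by have -> : j = j' by have := orbit_height d1 F1 s1 s1 E; lia.
  by have -> : j = j' by have := orbit_height d2 F2 s2 s2 E; lia.
- exact: new.
- by split=> /esym/(new j' i j iN)/esym.
- exact: IH.
Qed.

End Merge.

(** * Extension to the whole tree *)

(** The unmatched elements on both sides are equally numerous, and can be
    matched in the order of enumeration. *)
Lemma extend_matching (T1 T2 : pointedType) (A : {fset T1}) (B : {fset T2})
    (P : T1 -> T2 -> Prop) : #|` A| = #|` B| ->
  (forall x x', x \in A -> P x x' -> x' \in B) ->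
  (forall x x' y y', P x x' -> P y y' -> x = y <-> x' = y') ->
  exists f : T1 -> T2, [/\ forall x, x \in A -> f x \in B,
     forall x y, x \in A -> y \in A -> f x = f y -> x = y &
     forall x x', x \in A -> P x x' -> f x = x'].
Proof.
move=> AB PB Pinj; pose f1 x := xget (point : T2) [set x' | P x x'].
have f1P x x' : P x x' -> f1 x = x'.
  by move=> Px; apply/(Pinj x _ x x') => //; exact: (xgetI point Px).
pose A0 := [fset x in A | `[< exists x', P x x' >]]%fset.
have A0P x : x \in A0 = (x \in A) && `[< exists x', P x x' >].
  by rewrite in_fset_sep.
clearbody A0.
have Pf1 x : x \in A0 -> P x (f1 x).
  by rewrite A0P => /andP[_ /asboolP[x' Px]]; rewrite (f1P _ _ Px).
pose B0 := [fset f1 x | x in A0]%fset.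
have A0A : (A0 `<=` A)%fset by apply/fsubsetP => x; rewrite A0P => /andP[].
have B0B : (B0 `<=` B)%fset.
  apply/fsubsetP => _ /imfsetP[x /= xA0 ->]; apply: PB (Pf1 x xA0).
  exact: (fsubsetP A0A).
have AB0 : #|` A `\` A0|%fset = #|` B `\` B0|%fset.
  have -> : #|` B `\` B0|%fset = #|` B| - #|` B0|
    by rewrite cardfsD (fsetIidPr B0B).
  have -> : #|` B0| = #|` A0|.
    apply: card_in_imfset => x y /= /Pf1 Px /Pf1 Py E.
    by apply/(Pinj _ _ _ _ Px Py).
  by rewrite cardfsD (fsetIidPr A0A) AB.
pose f2 x := nth point (B `\` B0)%fset (index x (A `\` A0)%fset).
have f2B x : x \in A -> x \notin A0 -> f2 x \in (B `\` B0)%fset.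
  move=> xA xA0; apply: mem_nth; rewrite -[X in _ < X]AB0 index_mem.
  by rewrite in_fsetD xA0 xA.
exists (fun x => if x \in A0 then f1 x else f2 x); split.
- move=> x xA; case: ifP => [/Pf1|/negbT xA0]; first exact: PB.
  by have := f2B x xA xA0; rewrite in_fsetD => /andP[].
- move=> x y xA yA; case: ifP => [xA0|/negbT xA0];
    case: ifP => [yA0|/negbT yA0] E.
  + by apply/(Pinj _ _ _ _ (Pf1 _ xA0) (Pf1 _ yA0)).
  + have := f2B y yA yA0; rewrite -E in_fsetD => /andP[/negP H _].
    by case: H; apply/imfsetP; exists x.
  + have := f2B x xA xA0; rewrite E in_fsetD => /andP[/negP H _].
    by case: H; apply/imfsetP; exists y.
  + have xD : x \in (A `\` A0)%fset by rewrite in_fsetD xA0 xA.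
    have yD : y \in (A `\` A0)%fset by rewrite in_fsetD yA0 yA.
    move/eqP: E; rewrite nth_uniq ?fset_uniq -?[X in _ < X]AB0 ?index_mem //.
    by move/eqP/(congr1 (nth x (A `\` A0)%fset)); rewrite !nth_index.
- move=> x x' xA Px; rewrite ifT ?(f1P x x') // A0P xA.
  by apply/asboolP; exists x'.
Qed.

Section Glue.
Local Open Scope nat_scope.
Variables (R : realType) (T1 T2 : metrized_tree R).
Hypothesis N1 : normalized T1.
Hypothesis N2 : normalized T2.
Hypothesis lenE : forall n, has_spine T1 n <-> has_spine T2 n.
Hypothesis agree : forall n, has_spine T1 n -> orbits_agree T1 T2 n.
Local Notation up1 := (parent (inf_end T1)).
Local Notation up2 := (parent (inf_end T2)).
Local Notation F1 := (@dyn R T1).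
Local Notation F2 := (@dyn R T2).
Local Notation o1 := (base T1).
Local Notation o2 := (base T2).

Let d1 : global_degree T1 = 3. Proof. by case: N1. Qed.
Let d2 : global_degree T2 = 3. Proof. by case: N2. Qed.
Let Fo1 : F1 o1 = up1 o1. Proof. by case: N1. Qed.
Let Fo2 : F2 o2 = up2 o2. Proof. by case: N2. Qed.

Definition marked_pair (x : T1) (x' : T2) := exists i j,
  [/\ has_spine T1 i, x = iter j F1 (spine_pt T1 i) &
    x' = iter j F2 (spine_pt T2 i)].

(** This is the form in which the coincidences determined by the code are
    used. *)
Lemma marked_inj x x' y y' : marked_pair x x' -> marked_pair y y' ->
  x = y <-> x' = y'.
Proof.
move=> [i [j [si -> ->]]] [k [l [sk -> ->]]].
have [ik|ki] := leqP i k; first exact: (agree sk).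
exact: (agree si _ _ (leqnn i) (ltnW ki)).
Qed.

Lemma marked_dyn x x' : marked_pair x x' -> marked_pair (F1 x) (F2 x').
Proof. by move=> [i [j [si -> ->]]]; exists i, j.+1. Qed.

Lemma marked_up x x' : marked_pair x x' -> marked_pair (up1 x) (up2 x').
Proof.
move=> [[|i] [j [si -> ->]]].
  exists 0, j.+1; rewrite !(orbit_above d1 Fo1) // !(orbit_above d2 Fo2) //.
  by rewrite !subn0.
exists i, j; split; first exact: has_spineW si _.
  exact: orbit_up.
by rewrite (orbit_up d2) //; apply/lenE.
Qed.

Definition fibre1 (p y : T1) :=
  [fset c in children (inf_end T1) p | F1 c == y]%fset.
Definition fibre2 (p' y' : T2) :=
  [fset c in children (inf_end T2) p' | F2 c == y']%fset.

Lemma fibre1P p y c : c \in fibre1 p y <-> up1 c = p /\ F1 c = y.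
Proof.
rewrite in_fset_sep in_children; split=> [/andP[/eqP ? /eqP ?]//|[-> ->]].
by rewrite !eqxx.
Qed.

Lemma fibre2P p' y' c' : c' \in fibre2 p' y' <-> up2 c' = p' /\ F2 c' = y'.
Proof.
rewrite in_fset_sep in_children; split=> [/andP[/eqP ? /eqP ?]//|[-> ->]].
by rewrite !eqxx.
Qed.

Definition good_match p y p' y' (f : T1 -> T2) :=
  [/\ forall c, c \in fibre1 p y -> f c \in fibre2 p' y',
      forall c d, c \in fibre1 p y -> d \in fibre1 p y -> f c = f d -> c = d &
      forall c c', c \in fibre1 p y -> marked_pair c c' -> f c = c'].

Definition fibre_match p y p' y' : T1 -> T2 :=
  if pselect (exists f, good_match p y p' y' f) is left H then sval (cid H)
  else fun=> point.

(** Marked children go to marked children, and the others are matched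
    arbitrarily. *)
Lemma fibre_matchP p y p' y' : #|` fibre1 p y| = #|` fibre2 p' y'| ->
  (forall c c', c \in fibre1 p y -> marked_pair c c' -> c' \in fibre2 p' y') ->
  good_match p y p' y' (fibre_match p y p' y').
Proof.
move=> card mk; rewrite /fibre_match; case: pselect => [H|]; first exact: svalP.
by case; apply: (extend_matching card mk); exact: marked_inj.
Qed.

(** The vertices of depth at most n are mapped as desired; a vertex of the
    next depth goes to the partner of its parent, over the partner of its
    image. The base case takes care of the ray above the base. *)
Fixpoint glue n (x : T1) : T2 :=
  if n is n'.+1 then
    if `[< iter n up1 x = o1 >] then
      fibre_match (up1 x) (F1 x) (glue n' (up1 x)) (glue n' (F1 x)) x
    else glue n' x
  else iter (xget 0 [set i | x = iter i up1 o1]) up2 o2.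

Lemma glue_above n i : glue n (iter i up1 o1) = iter i up2 o2.
Proof.
elim: n => [|n IH] /=.
  by congr iter; apply: xget_unique => // j /above_inj.
by rewrite asboolF // -iterS -iterD addSn => /(@above_inj _ _ _ 0).
Qed.

Lemma glue_stable n d x : d <= n -> iter d up1 x = o1 -> glue n x = glue d x.
Proof.
elim: n => [|n IH]; first by rewrite leqn0 => /eqP ->.
rewrite leq_eqVlt => /orP[/eqP -> //|]; rewrite ltnS => dn xd.
rewrite [LHS]/= asboolF ?IH // -iterS => xn.
by have := depth_unique xd xn; lia.
Qed.

(** The induction hypothesis of the construction. Injectivity is part of it
    because the spine must be recognized in the image. *)
Definition coherent n := [/\
  forall d x, d <= n -> iter d up1 x = o1 -> iter d up2 (glue n x) = o2,
  forall d x y, d <= n -> iter d up1 x = o1 -> iter d up1 y = o1 ->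
     glue n x = glue n y -> x = y,
  forall d x, d <= n -> iter d up1 x = o1 ->
     glue n (up1 x) = up2 (glue n x) /\ glue n (F1 x) = F2 (glue n x) &
  forall d x x', d <= n -> iter d up1 x = o1 -> marked_pair x x' ->
    glue n x = x'].

Lemma coherent0 : coherent 0.
Proof.
split=> d x; rewrite ?leqn0.
- by move=> /eqP -> /= ->; exact: (glue_above 0 0).
- by move=> y /eqP -> /= -> ->.
- move=> /eqP -> /= ->; rewrite Fo1.
  have E0 := glue_above 0 0; have E1 := glue_above 0 1; rewrite /= in E0 E1.
  by rewrite /= E0 E1 Fo2.
- move=> x' /eqP -> xo mx; have E0 := glue_above 0 0.
  rewrite (xo : x = o1) [LHS]E0.
  by apply/(marked_inj (x := o1) (y := x)) => //; exists 0, 0.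
Qed.

Lemma mark_spine_pt n : has_spine T1 n ->
  marked_pair (spine_pt T1 n) (spine_pt T2 n).
Proof. by move=> sn; exists n, 0. Qed.

(** The formula of [card_fibre] only involves coincidences with marked
    vertices, which are respected. *)
Lemma card_fibre_eq n p y : coherent n -> iter n up1 p = o1 -> up1 y = F1 p ->
  #|` fibre1 p y| = #|` fibre2 (glue n p) (glue n y)|.
Proof.
move=> [Hd Hi Hc Hm] np yp.
have yn : iter n up1 y = o1.
  case: n np {Hd Hi Hc Hm} => [|n] np.
    by apply: (up_o_child (@valence_above _ T1) (i := 0));
      rewrite yp (np : p = o1).
  by rewrite iterSr yp; apply: (depth_dyn d1 Fo1).
have y'p' : up2 (glue n y) = F2 (glue n p).
  have [<- _] := Hc n y (leqnn n) yn; have [_ <-] := Hc n p (leqnn n) np.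
  by rewrite yp.
rewrite (card_fibre d1 Fo1 np yp)
  (card_fibre d2 Fo2 (Hd n p (leqnn n) np) y'p').
have spE : has_spine T1 n -> p = spine_pt T1 n <-> glue n p = spine_pt T2 n.
  move=> sn; have E := Hm n _ _ (leqnn n) (depth_spine_pt sn)
    (mark_spine_pt sn).
  split=> [->//|]; rewrite -E; apply: (Hi n) => //; exact: depth_spine_pt.
have depF i : has_spine T1 i.+1 -> iter i up1 (F1 (spine_pt T1 i.+1)) = o1.
  by move=> si; apply: (depth_dyn d1 Fo1); exact: depth_spine_pt.
have FspE : has_spine T1 n.+1 ->
  y = F1 (spine_pt T1 n.+1) <-> glue n y = F2 (spine_pt T2 n.+1).
  move=> sn; have E := Hm n _ _ (leqnn n) (depF _ sn)
    (marked_dyn (mark_spine_pt sn)).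
  split=> [->//|]; rewrite -E; apply: (Hi n) => //; exact: depF.
rewrite (vdeg_depth d1 Fo1 np) (vdeg_depth d2 Fo2 (Hd n p (leqnn n) np)).
congr (_ - nat_of_bool _).
  rewrite (@asbool_equiv_eq _ (has_spine T2 n /\ glue n p = spine_pt T2 n)) //.
  split=> -[sn E]; split.
  - exact/lenE. - exact/spE. - exact/lenE.
  - by apply/spE => //; exact/lenE.
apply: asbool_equiv_eq; split=> -[sn Ep Ey].
  have sn' : has_spine T1 n := has_spineW sn (leqnSn n).
  by split; [exact/lenE|exact/spE|exact/FspE].
have sn1 : has_spine T1 n.+1 by apply/lenE.
have sn' : has_spine T1 n := has_spineW sn1 (leqnSn n).
by split=> //; [exact/spE|exact/FspE].
Qed.

Lemma glue_step n x : coherent n -> iter n.+1 up1 x = o1 ->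
  let f := glue n.+1 in
  [/\ up2 (f x) = glue n (up1 x), F2 (f x) = glue n (F1 x),
     forall y, iter n.+1 up1 y = o1 -> f x = f y -> x = y &
     forall x', marked_pair x x' -> f x = x'].
Proof.
move=> co nx f; have [Hd Hi Hc Hm] := co.
have fE y : iter n.+1 up1 y = o1 ->
    f y = fibre_match (up1 y) (F1 y) (glue n (up1 y)) (glue n (F1 y)) y.
  by move=> ny; rewrite /f /= asboolT.
have M y : iter n.+1 up1 y = o1 -> good_match (up1 y) (F1 y) (glue n (up1 y))
    (glue n (F1 y)) (fibre_match (up1 y) (F1 y) (glue n (up1 y))
      (glue n (F1 y))).
  move=> ny; have uy : iter n up1 (up1 y) = o1 by rewrite -iterSr.
  have Fy := depth_dyn d1 Fo1 ny.
  apply: fibre_matchP; first by apply: card_fibre_eq; rewrite ?(dyn_up d1).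
  move=> c c' /fibre1P[cy Fc] mc; apply/fibre2P; split; apply/esym.
    by apply: (Hm n) => //; rewrite -cy; exact: marked_up.
  by apply: (Hm n) => //; rewrite -Fc; exact: marked_dyn.
have xf : x \in fibre1 (up1 x) (F1 x) by apply/fibre1P.
have [M1 M2 M3] := M x nx.
have fP y : iter n.+1 up1 y = o1 ->
  up2 (f y) = glue n (up1 y) /\ F2 (f y) = glue n (F1 y).
  move=> ny; rewrite fE //; have [M1' _ _] := M y ny.
  by apply/fibre2P/M1'/fibre1P.
have [fu fF] := fP x nx.
split=> // [y ny E|x' mx]; last by rewrite fE //; exact: M3.
have [fu' fF'] := fP y ny.
have uu : up1 y = up1 x.
  by apply: (Hi n) => //; rewrite -?iterSr // -fu' -fu E.
have FF : F1 y = F1 x.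
  by apply: (Hi n) => //; rewrite ?(depth_dyn d1 Fo1) // -fF' -fF E.
move: E; rewrite !fE // uu FF; apply: M2 => //.
by apply/fibre1P.
Qed.

Lemma coherentP n : coherent n.
Proof.
elim: n => [|n IH]; first exact: coherent0.
have [Hd Hi Hc Hm] := IH; have old d x : d <= n -> iter d up1 x = o1 ->
    glue n.+1 x = glue n x.
  by move=> dn dx; rewrite !(@glue_stable _ d) //; exact: leqW.
split=> d x.
- rewrite leq_eqVlt ltnS => /orP[/eqP ->|dn] dx; last by rewrite (old d) ?Hd.
  have [fu _ _ _] := glue_step IH dx.
  by rewrite iterSr fu; apply: Hd; rewrite -?iterSr.
- move=> y; rewrite leq_eqVlt ltnS => /orP[/eqP ->|dn] dx dy.
    by have [_ _ H _] := glue_step IH dx; exact: H.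
  by rewrite !(old d) //; exact: (Hi d).
- rewrite leq_eqVlt ltnS => /orP[/eqP ->|dn] dx.
    have [fu fF _ _] := glue_step IH dx.
    rewrite fu fF; have Fx := depth_dyn d1 Fo1 dx.
    by rewrite !(old n) // -iterSr.
  rewrite (old d x) //; have [<- <-] := Hc d x dn dx.
  suff [-> ->] : glue n.+1 (up1 x) = glue n (up1 x) /\
      glue n.+1 (F1 x) = glue n (F1 x) by [].
  case: d dn dx => [|d] dn dx.
    rewrite (dx : x = o1) Fo1.
    by split; rewrite -[up1 o1]/(iter 1 up1 o1) !glue_above.
  have Fx := depth_dyn d1 Fo1 dx.
  by split; apply: (old d); rewrite -?iterSr //; exact: ltnW.
- move=> x'; rewrite leq_eqVlt ltnS => /orP[/eqP ->|dn] dx mx.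
    by have [_ _ _ H] := glue_step IH dx; exact: H.
  by rewrite (old d) //; exact: (Hm d).
Qed.

(** Vertices above the base get the default value 0, which suits [glue]. *)
Definition depth_of (x : T1) := xget 0 [set n | iter n up1 x = o1].
Definition tree_iso x := glue (depth_of x) x.

Lemma tree_isoE n x : iter n up1 x = o1 -> tree_iso x = glue n x.
Proof.
move=> nx; rewrite /tree_iso (_ : depth_of x = n) //.
by apply: xget_unique => // m mx; exact: depth_unique mx nx.
Qed.

Lemma tree_iso_above i : tree_iso (iter i up1 o1) = iter i up2 o2.
Proof. exact: glue_above. Qed.

Lemma tree_iso_depth n x : iter n up1 x = o1 -> iter n up2 (tree_iso x) = o2.
Proof.
by move=> nx; rewrite (tree_isoE nx); have [H _ _ _] := coherentP n; exact: H.
Qed.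

Lemma tree_iso_morph x : tree_iso (up1 x) = up2 (tree_iso x) /\
  tree_iso (F1 x) = F2 (tree_iso x).
Proof.
have [[i ->]|[[|n] nx]] := above_or_below (@valence_above _ T1) x.
- by rewrite (dyn_above d1 Fo1) !tree_iso_above (dyn_above d2 Fo2).
- rewrite (nx : x = o1) Fo1 -[up1 o1]/(iter 1 up1 o1) (tree_iso_above 1).
  by have E := tree_iso_above 0; rewrite /= in E; rewrite E Fo2.
have [_ _ H _] := coherentP n.+1; have [Hu HF] := H _ _ (leqnn _) nx.
have ux : iter n up1 (up1 x) = o1 by rewrite -iterSr.
have Fx := depth_dyn d1 Fo1 nx.
rewrite (tree_isoE nx) -Hu -HF (tree_isoE ux) (tree_isoE Fx).
by rewrite !(@glue_stable n.+1 n).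
Qed.

Lemma tree_iso_inj : injective tree_iso.
Proof.
have mixed i n y : iter n up1 y = o1 -> tree_iso y <> iter i.+1 up2 o2.
  by move=> /tree_iso_depth + E; rewrite E => /not_above_depth.
move=> x y; have [[i ->]|[n nx]] := above_or_below (@valence_above _ T1) x;
  have [[j ->]|[m my]] := above_or_below (@valence_above _ T1) y.
- by rewrite !tree_iso_above => /above_inj ->.
- by rewrite tree_iso_above => /esym/(mixed _ _ _ my).
- by rewrite tree_iso_above => /(mixed _ _ _ nx).
move=> E; have nm : n = m.
  by apply: (depth_unique (tree_iso_depth nx)); rewrite E tree_iso_depth.
subst m; have [_ H _ _] := coherentP n; apply: (H n) => //.
by rewrite -(tree_isoE nx) -(tree_isoE my).
Qed.

(** An injection between fibres of the same size is onto. *)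
Lemma tree_iso_depth_surj n y' : iter n up2 y' = o2 ->
  exists x, iter n up1 x = o1 /\ tree_iso x = y'.
Proof.
elim: n y' => [|n IH] y' ny'.
  by exists o1; split=> //; rewrite (tree_iso_above 0) -ny'.
have [p [np pE]] := IH (up2 y') (etrans (esym (iterSr _ _ _)) ny').
have [y [ny yE]] := IH (F2 y') (depth_dyn d2 Fo2 ny').
have yp : up1 y = F1 p.
  apply: tree_iso_inj; have [-> _] := tree_iso_morph y;
    have [_ ->] := tree_iso_morph p.
  by rewrite yE pE (dyn_up d2).
have card := card_fibre_eq (coherentP n) np yp.
rewrite -(tree_isoE np) -(tree_isoE ny) pE yE in card.
have sub : ([fset tree_iso c | c in fibre1 p y] `<=` fibre2 (up2 y')
  (F2 y'))%fset.
  apply/fsubsetP => _ /imfsetP[c /= /fibre1P[cp cy] ->]; apply/fibre2P.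
  by have [<- <-] := tree_iso_morph c; rewrite cp cy pE yE.
have : y' \in [fset tree_iso c | c in fibre1 p y]%fset.
  have /eqP -> : [fset tree_iso c | c in fibre1 p y]%fset == fibre2 (up2 y')
    (F2 y').
    have ci : #|` [fset tree_iso c | c in fibre1 p y]%fset| = #|` fibre1 p y|.
      by apply: card_imfset => /=; exact: tree_iso_inj.
    by rewrite eqEfcard sub -card ci leqnn.
  by apply/fibre2P.
move=> /imfsetP[c /= /fibre1P[cp cy] ->]; exists c; split; last by [].
by rewrite -iterS iterSr cp.
Qed.

Lemma tree_iso_bij : bijective tree_iso.
Proof.
have surj y' : exists x, tree_iso x = y'.
  have [[i ->]|[n ny']] := above_or_below (@valence_above _ T2) y'.
    by exists (iter i.+1 up1 o1); exact: tree_iso_above.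
  by have [x [_ <-]] := tree_iso_depth_surj ny'; exists x.
pose inv y' := xget point [set x | tree_iso x = y'].
have invK y' : tree_iso (inv y') = y'.
  by have [x xE] := surj y'; exact: (xgetI point (xE :
    [set x | tree_iso x = y'] x)).
by exists inv => // x; apply: tree_iso_inj; rewrite invK.
Qed.

End Glue.

(** * Similarity *)

Section Distances.
Local Open Scope ring_scope.
Variables (R : realType) (T1 T2 : metrized_tree R).
Hypothesis deg1 : global_degree T1 = 3%N.
Hypothesis deg2 : global_degree T2 = 3%N.
Local Notation up1 := (parent (inf_end T1)).
Local Notation up2 := (parent (inf_end T2)).
Local Notation o1 := (base T1).
Local Notation o2 := (base T2).
Hypothesis Fo1 : dyn o1 = up1 o1.
Hypothesis Fo2 : dyn o2 = up2 o2.
Variable f : T1 -> T2.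
Hypothesis f_inj : injective f.
Hypothesis f_up : forall x, f (up1 x) = up2 (f x).
Hypothesis f_dyn : forall x, f (dyn x) = dyn (f x).
Hypothesis f_base : f o1 = o2.

Let ratio := dist o2 (up2 o2) / dist o1 (up1 o1).

(** Both sides are tripled when x is replaced by its image, so that it
    suffices to follow x until it is on the ray, and to know the edge [v0,
    v1]. *)
Lemma edge_ratio x : dist (f x) (f (up1 x)) = ratio * dist x (up1 x).
Proof.
have base_ratio : dist o2 (up2 o2) = ratio * dist o1 (up1 o1).
  by rewrite /ratio divfK // gt_eqF // dist_up_gt0.
have three y : dist (f (dyn y)) (f (up1 (dyn y))) =
  ratio * dist (dyn y) (up1 (dyn y))
    <-> dist (f y) (f (up1 y)) = ratio * dist y (up1 y).
  rewrite !f_up f_dyn (dist_up_F deg1) (dist_up_F deg2) mulrCA.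
  by split=> [|->//]; apply: mulfI; rewrite pnatr_eq0.
have above i : dist (f (iter i up1 o1)) (f (iter i.+1 up1 o1)) =
    ratio * dist (iter i up1 o1) (iter i.+1 up1 o1).
  elim: i => [|i IH]; first by rewrite /= f_up f_base base_ratio.
  by move/three: IH; rewrite (dyn_above deg1 Fo1).
have [[i ->]|[n]] := above_or_below (@valence_above _ T1) x; first exact: above.
elim: n x => [|n IH] x nx; first by rewrite (nx : x = o1) (above 0%N).
by apply/three; apply: IH; exact: (depth_dyn deg1 Fo1).
Qed.

Lemma f_adj x y : adj x y -> adj (f x) (f y).
Proof.
by case/(adj_parent (inf_end T1)) => ->;
  rewrite f_up ?parent_adj // adj_sym parent_adj.
Qed.

Lemma adj_ratio x y : adj x y -> dist (f x) (f y) = ratio * dist x y.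
Proof.
case/(adj_parent (inf_end T1)) => ->; first exact: edge_ratio.
by rewrite (dist_sym (distP T2)) edge_ratio (dist_sym (distP T1)).
Qed.

(** Distances are sums of lengths of edges along simple paths, and f maps
    simple paths to simple paths. *)
Lemma dist_ratio x y : dist (f x) (f y) = ratio * dist x y.
Proof.
have [p pp <-] := tree_connected x y; case/shortenP: pp => q qp uq _ {p y}.
elim: q x qp uq => [|a q IH] x /=.
  by rewrite !dist_refl mulr0.
move=> /andP[xa aq] /andP[xq uq].
have D (T : metrized_tree R) (z b : T) r : path (@adj T) z (b :: r) ->
  uniq (z :: b :: r) ->
    dist z (last b r) = dist z b + dist b (last b r).
  move=> pr ur; have := dist_path (distP T) pr ur (y := b).
  by move=> <- //; rewrite !inE eqxx orbT.
rewrite (D T1 x a q); [|by apply/andP|by apply/andP].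
rewrite mulrDr -IH // -adj_ratio // -last_map; apply: D.
  rewrite /= f_adj //=; elim: q a aq {IH xa xq uq} => //= b q IH a /andP[ab bq].
  by rewrite f_adj //= IH.
by rewrite -!map_cons map_inj_uniq //= xq.
Qed.

Lemma ratio_gt0 : 0 < ratio.
Proof. by rewrite divr_gt0 ?dist_up_gt0. Qed.

End Distances.

Theorem theorem11p3 (R : realType) (T1 T2 : metrized_tree R)
    (hT1 : in_PT3_2 T1 \/ in_PT3_1 T1) (hT2 : in_PT3_2 T2 \/ in_PT3_1 T2)
    (hcode : forall i : nat, tree_code T1 i = tree_code T2 i) :
  proj_equiv T1 T2.
Proof.
have N1 := PT3_normalized hT1; have N2 := PT3_normalized hT2.
have agree := code_orbits_agree N1 N2 hcode.
have lenE n : has_spine T1 n <-> has_spine T2 n by case: (agree n).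
have {}agree n : has_spine T1 n -> orbits_agree T1 T2 n by case: (agree n).
have [[d1 F1 _] [d2 F2 _]] := (N1, N2).
have isoP := tree_iso_morph N1 N2 lenE agree.
have io : tree_iso T2 (base T1) = base T2 := tree_iso_above T1 T2 0.
eexists; split; last exists (tree_iso T2).
  exact: (ratio_gt0 T1 T2).
split; first exact: tree_iso_bij.
  apply: (dist_ratio d1 d2 F1) io => //.
  - exact: tree_iso_inj.
  - by move=> x; case: (isoP x).
  - by move=> x; case: (isoP x).
by move=> x; case: (isoP x).
Qed.
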